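(* For every $\gamma\in[0,\pi)$, the Hilbert space $\mathcal{B}_{+2}^{(\gamma)}$, i.e. $\operatorname{dom}(S_\gamma)$ equipped with the graph inner product $\langle f,g\rangle_{+2}=\langle S_\gamma f,S_\gamma g\rangle+\langle f,g\rangle$, is a de Branges (dB) space.
   Context: Inner products are conjugate linear in the left argument. For an entire function $f$, $f^\#(z):=\overline{f(\overline z)}$. A Hilbert space of entire functions is a de Branges (dB) space if it has a reproducing kernel (point evaluations are continuous) and is isometrically invariant under $f\mapsto f^\#$ and under $f(z)\mapsto \frac{z-\overline w}{z-w}f(z)$ whenever $w\in\mathbb{C}\setminus\mathbb{R}$ is a non-real zero of $f$. The Hermite-Biehler class consists of entire $e$ with $|e(z)|>|e(\overline z)|$ for all $z$ with $\operatorname{Im} z>0$; for such $e$, $\mathcal{B}(e)$ is the space of entire $f$ with $f/e,\,f^\#/e\in H^2(\mathbb{C}_+)$ (Hardy space of the upper half plane), with inner product $\langle f,g\rangle=\int_{\mathbb{R}}\frac{\overline{f(x)}g(x)}{|e(x)|^2}dx$. Every nonzero dB space equals some $\mathcal{B}(e)$ isometrically. Fix a nonzero dB space $\mathcal{B}=\mathcal{B}(e)$ with $e$ in the Hermite-Biehler class and without real zeros (standing assumption). For $\gamma\in[0,\pi)$ put $s_\gamma(z)=\frac{i}{2}[e^{i\gamma}e(z)-e^{-i\gamma}e^\#(z)]$. $S$ is the operator of multiplication by the independent variable on its maximal domain in $\mathcal{B}$; it is assumed throughout that $\operatorname{dom}(S)$ is dense. The canonical selfadjoint extensions of $S$ are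 $S_\gamma$, $\gamma\in[0,\pi)$: with any $w\in\mathbb{C}\setminus\mathbb{R}$, $$\operatorname{dom}(S_\gamma)=\left\{g(z)=\frac{f(z)-\frac{s_\gamma(z)}{s_\gamma(w)}f(w)}{z-w}: f\in\mathcal{B}\right\},\qquad S_\gamma g(z)=zg(z)+f(w)\frac{s_\gamma(z)}{s_\gamma(w)},$$ (the operator does not depend on $w$). *)

(* Defs.v *)
From HB Require Import structures.
From mathcomp Require Import all_boot all_order all_algebra.
From mathcomp Require Import complex.
From mathcomp Require Import all_classical all_reals all_analysis.

Set Implicit Arguments.
Unset Strict Implicit.
Unset Printing Implicit Defensive.

Import Order.TTheory GRing.Theory Num.Theory.
Import numFieldNormedType.Exports.

Local Open Scope classical_set_scope.
Local Open Scope ring_scope.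
Local Open Scope complex_scope.

(* The topology and the normed-module structure used by [derivable] are found
   on a type declared as a numClosedFieldType, not on [complex R] itself. *)
Definition Cfield (R : realType) : numClosedFieldType := R[i].

(* Directional derivative over the scalar field C: complex differentiability. *)
Definition cdifferentiable (R : realType) (f : R[i] -> R[i]) (z : R[i]) : Prop :=
  derivable (f : Cfield R -> Cfield R) (z : Cfield R) 1.

Definition entire (R : realType) (f : R[i] -> R[i]) : Prop :=
  forall z, cdifferentiable f z.

Definition sharp (R : realType) (f : R[i] -> R[i]) : R[i] -> R[i] :=
  fun z => conjc (f (conjc z)).

Definition nonreal (R : realType) (w : R[i]) : Prop := complex.Im w != 0.

(* A set of functions together with a candidate inner product; only the values
   of [fs_ip] on members of [fs_mem] are meaningful. *)
Record fspace (R : realType) := Fspace {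
  fs_mem : set (R[i] -> R[i]);
  fs_ip : (R[i] -> R[i]) -> (R[i] -> R[i]) -> R[i]
}.

Definition fs_norm (R : realType) (H : fspace R) (f : R[i] -> R[i]) : R :=
  Num.sqrt (complex.Re (fs_ip H f f)).

Definition fs_subspace (R : realType) (H : fspace R) : Prop :=
  [/\ fs_mem H (fun=> 0),
      forall f g, fs_mem H f -> fs_mem H g -> fs_mem H (fun z => f z + g z) &
      forall a f, fs_mem H f -> fs_mem H (fun z => a * f z)].

(* Linear in the right argument; conjugate linearity in the left one follows
   from hermitian symmetry.  In the order of R[i], [0 <= x] means that x is
   real and nonnegative. *)
Definition fs_inner_product (R : realType) (H : fspace R) : Prop :=
  [/\ forall f g, fs_mem H f -> fs_mem H g ->
        fs_ip H f g = conjc (fs_ip H g f),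
      forall f g h, fs_mem H f -> fs_mem H g -> fs_mem H h ->
        fs_ip H f (fun z => g z + h z) = fs_ip H f g + fs_ip H f h,
      forall a f g, fs_mem H f -> fs_mem H g ->
        fs_ip H f (fun z => a * g z) = a * fs_ip H f g,
      forall f, fs_mem H f -> 0 <= fs_ip H f f &
      forall f, fs_mem H f -> fs_ip H f f = 0 -> f = (fun=> 0)].

Definition fs_complete (R : realType) (H : fspace R) : Prop :=
  forall u : nat -> R[i] -> R[i],
    (forall n, fs_mem H (u n)) ->
    (forall eps : R, 0 < eps -> exists N : nat, forall m n : nat,
       (N <= m)%N -> (N <= n)%N -> fs_norm H (fun z => u m z - u n z) < eps) ->
    exists2 f, fs_mem H f &
      forall eps : R, 0 < eps -> exists N : nat, forall n : nat,
        (N <= n)%N -> fs_norm H (fun z => u n z - f z) < eps.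

Definition fs_evaluation_continuous (R : realType) (H : fspace R) : Prop :=
  forall w f, fs_mem H f -> forall eps : R, 0 < eps ->
    exists2 delta : R, 0 < delta & forall g, fs_mem H g ->
      fs_norm H (fun z => g z - f z) < delta -> complex.Re `|g w - f w| < eps.

Definition hilbert_of_entire (R : realType) (H : fspace R) : Prop :=
  [/\ (forall f, fs_mem H f -> entire f), fs_subspace H,
      fs_inner_product H & fs_complete H].

(* In the last clause g is the function (z - conj w) / (z - w) f(z): the quotient
   has a removable singularity at w, and g, being a member of a space of entire
   functions, is its unique entire extension. *)
Definition dB_space (R : realType) (H : fspace R) : Prop :=
  [/\ hilbert_of_entire H,
      fs_evaluation_continuous H,
      forall f, fs_mem H f ->
        fs_mem H (sharp f) /\ fs_norm H (sharp f) = fs_norm H f &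
      forall f w, fs_mem H f -> nonreal w -> f w = 0 ->
        exists g, [/\ fs_mem H g,
          forall z, z != w -> g z = (z - conjc w) / (z - w) * f z &
          fs_norm H g = fs_norm H f]].

Definition fs_nonzero (R : realType) (H : fspace R) : Prop :=
  exists2 f, fs_mem H f & exists z, f z != 0.

Definition fs_isometric_eq (R : realType) (H K : fspace R) : Prop :=
  fs_mem H = fs_mem K /\
  forall f g, fs_mem H f -> fs_mem H g -> fs_ip H f g = fs_ip K f g.

Definition hermite_biehler (R : realType) (e : R[i] -> R[i]) : Prop :=
  entire e /\ forall z, 0 < complex.Im z -> `|e (conjc z)| < `|e z|.

Definition hardy2 (R : realType) (F : R[i] -> R[i]) : Prop :=
  (forall z, 0 < complex.Im z -> cdifferentiable F z) /\
  exists M : R, forall y : R, 0 < y ->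
    (\int[@lebesgue_measure R]_(x in setT)
       ((complex.Re `|F (x +i* y)|) ^+ 2)%:E <= M%:E)%E.

Definition cintegral (R : realType) (F : R -> R[i]) : R[i] :=
  Rintegral (@lebesgue_measure R) setT (fun x => complex.Re (F x)) +i*
  Rintegral (@lebesgue_measure R) setT (fun x => complex.Im (F x)).

Definition dB_of (R : realType) (e : R[i] -> R[i]) : fspace R :=
  Fspace
    [set f | [/\ entire f, hardy2 (fun z => f z / e z) &
                 hardy2 (fun z => sharp f z / e z)]]
    (fun f g =>
       cintegral (fun x => conjc (f x%:C) * g x%:C / `|e x%:C| ^+ 2)).

Definition cis (R : realType) (t : R) : R[i] := cos t +i* sin t.

Definition s_fun (R : realType) (e : R[i] -> R[i]) (gamma : R) : R[i] -> R[i] :=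
  fun z => ((0 +i* 1) / 2%:R) *
           (cis gamma * e z - cis (- gamma) * sharp e z).

Definition dom_S (R : realType) (B : fspace R) : set (R[i] -> R[i]) :=
  [set f | fs_mem B f /\ fs_mem B (fun z => z * f z)].

Definition fs_dense (R : realType) (B : fspace R) (D : set (R[i] -> R[i])) : Prop :=
  forall f, fs_mem B f -> forall eps : R, 0 < eps ->
    exists2 g, D g & fs_norm B (fun z => f z - g z) < eps.

(* The pairs (g, h) with h = S_gamma g, computed with base point w. *)
Definition graph_S_gamma (R : realType) (B : fspace R) (e : R[i] -> R[i])
    (gamma : R) (w : R[i]) (g h : R[i] -> R[i]) : Prop :=
  let s := s_fun e gamma in
  exists f, [/\ fs_mem B f, entire g,
    forall z, z != w -> g z = (f z - s z / s w * f w) / (z - w) &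
    h = (fun z => z * g z + f w * (s z / s w))].

Definition dom_S_gamma (R : realType) (B : fspace R) (e : R[i] -> R[i])
    (gamma : R) (w : R[i]) : set (R[i] -> R[i]) :=
  [set g | exists h, graph_S_gamma B e gamma w g h].

(* When dom(S) is dense, s_gamma is not in B and the graph is single-valued. *)
Definition S_gamma (R : realType) (B : fspace R) (e : R[i] -> R[i])
    (gamma : R) (w : R[i]) (g : R[i] -> R[i]) : R[i] -> R[i] :=
  xget (fun=> 0) [set h | graph_S_gamma B e gamma w g h].

Definition graph_space (R : realType) (B : fspace R) (e : R[i] -> R[i])
    (gamma : R) (w : R[i]) : fspace R :=
  let T := S_gamma B e gamma w in
  Fspace (dom_S_gamma B e gamma w)
    (fun f g => fs_ip B (T f) (T g) + fs_ip B f g).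

(* Main.v *)
Require Import Defs.
From HB Require Import structures.
From mathcomp Require Import all_boot all_order all_algebra.
From mathcomp Require Import complex.
From mathcomp Require Import all_classical all_reals all_analysis.
From mathcomp Require Import measurable_realfun.
From mathcomp Require Import ring lra.

Set Implicit Arguments.
Unset Strict Implicit.
Unset Printing Implicit Defensive.

Import Order.TTheory GRing.Theory Num.Theory.
Import numFieldNormedType.Exports.

Local Open Scope classical_set_scope.
Local Open Scope ring_scope.
Local Open Scope complex_scope.

(** Write s for s_gamma, and call (g, h) an extension pair when g and h belong to B
    and h = z g + c s for some constant c.  This description of the graph of
    S_gamma does not mention w, and once it is available each property of a de
    Branges space is a short computation with pairs.

    - The graph is the set of extension pairs (graph_S_gammaE).  The point is that
      the difference quotient (f - f(w) s / s(w)) / (z - w) of an f in B lies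
      again in B, which is an estimate in the Hardy space
      (hardy2_difference_quotient); conversely f = h - w g.
    - Completeness: point evaluations are continuous on B, so the relation
      h = z g + c s passes to limits (extension_pair_closed).
    - Reflection: s^# = s, hence (g^#, h^#) is a pair with the pair (g, h).
    - Division: if g(v) = 0 and g' = (z - conj v) / (z - v) g, then
      h' = h - conj v g + v g' makes (g', h') a pair, with the same c.  It says
      that g' is the Cayley transform of g, which for a symmetric operator
      preserves the graph norm (cayley_norm).
    - S_gamma is a function: by symmetry, a difference of two values at the same g
      is orthogonal to dom S, which is dense (extension_pair_unique).

    So everything rests on the symmetry of S_gamma, that is, on <g, h> being real
    for every pair (extension_pair_form_real).  As s is real on the real line, the
    imaginary part of <g, h> is the integral of s k / |e|^2, where
    k = (c g^# - conj c g) / 2i, and that is the integral of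
    Im (e^(-i gamma) k / e).  In z k the multiples of s cancel, so k and z k are
    both in B, and what remains is Cauchy's theorem: if F = e^(-i gamma) k / e and
    z F have bounded L^2 norms on the horizontal lines of the upper half plane,
    then F has integral zero over the real line
    (de_branges_integral_vanishes).

    Cauchy's theorem is proved for closed real forms u dx + v dy.  Goursat's
    bisection argument gives it on rectangles (goursat_rectangle), with
    differentiability relative to the closed half plane, so that rectangles may
    stand on the real line.  To move the line of integration from height 0 to
    height Y one must see that the integral of F over the vertical segment of
    abscissa b is small for large |b|.  The L^2 bounds control F on horizontal
    lines only, and a second application of Cauchy's theorem, to a primitive of F,
    converts that into the required bound
    (primitive_vertical_increment).  With b = t^4 and Y = t^3 all errors are
    O(1/t). *)

(** * Integrals over segments *)

Definition segment_integral (R : realType) (a b : R) (f : R -> R) : R :=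
  Rintegral (@lebesgue_measure R) `[a, b] f.

Definition segment_integrable (R : realType) (a b : R) (f : R -> R) : Prop :=
  (@lebesgue_measure R).-integrable `[a, b] (EFin \o f).

Definition half_line_continuous (R : realType) (A : R) (f : R -> R) : Prop :=
  forall x0, A <= x0 -> forall eps, 0 < eps -> exists2 delta, 0 < delta &
    forall x, A <= x -> `|x - x0| < delta -> `|f x - f x0| <= eps.

Lemma half_line_continuous_integrable (R : realType) (A a b : R) (f : R -> R) :
  half_line_continuous A f -> A <= a -> segment_integrable a b f.
Proof.
move=> cf Aa; apply: continuous_compact_integrable; first exact: segment_compact.
apply/subspace_continuousP => x /=; rewrite in_itv/= => /andP[ax xb].
apply/cvgrPdist_le => eps eps0.
have [d d0 dP] := cf x (le_trans Aa ax) eps eps0.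
apply: filterS (nbhsx_ballx x d d0) => y /= yd.
rewrite in_itv/= => /andP[ay _]; rewrite distrC; apply: dP.
  exact: le_trans Aa ay.
by rewrite distrC.
Qed.

Lemma segment_integral_split (R : realType) (a m b : R) (f : R -> R) :
  a <= m -> m <= b -> segment_integrable a b f ->
  segment_integral a b f = segment_integral a m f + segment_integral m b f.
Proof.
move=> am mb itf; apply/eqP; rewrite addrC -subr_eq; apply/eqP.
rewrite /segment_integral Rintegral_itvB ?bnd_simp//.
apply: Rintegral_itv_obnd_cbnd; apply: integrableS itf => //.
by apply: subset_itv; rewrite bnd_simp.
Qed.

Lemma segment_integralB (R : realType) (a b : R) (f g : R -> R) :
  segment_integrable a b f -> segment_integrable a b g ->
  segment_integral a b (fun x => f x - g x) =
  segment_integral a b f - segment_integral a b g.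
Proof. by move=> itf itg; apply: RintegralB. Qed.

Lemma segment_integrableB (R : realType) (a b : R) (f g : R -> R) :
  segment_integrable a b f -> segment_integrable a b g ->
  segment_integrable a b (fun x => f x - g x).
Proof. by move=> itf itg; exact: (integrableB _ itf itg). Qed.

Lemma segment_integrable_cst (R : realType) (a b k : R) :
  segment_integrable a b (fun=> k).
Proof.
apply: (@half_line_continuous_integrable _ a) => // x _ eps eps0.
by exists 1 => // y _ _; rewrite subrr normr0 ltW.
Qed.

Lemma segment_integral_cst (R : realType) (a b k : R) :
  a <= b -> segment_integral a b (fun=> k) = k * (b - a).
Proof.
move=> ab; rewrite /segment_integral Rintegral_cst//; congr (_ * _).
have := @lebesgue_measure_itv R `[a, b]; rewrite /= => ->.
move: ab; rewrite le_eqVlt => /predU1P[->|ab]; first by rewrite ltxx subrr.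
by rewrite lte_fin ab -EFinB.
Qed.

Lemma le_segment_integral (R : realType) (a b : R) (f g : R -> R) :
  segment_integrable a b f -> segment_integrable a b g ->
  (forall x, a <= x -> x <= b -> f x <= g x) ->
  segment_integral a b f <= segment_integral a b g.
Proof.
move=> itf itg fg; apply: le_Rintegral => // x /=; rewrite in_itv/= => /andP[? ?].
exact: fg.
Qed.

Lemma segment_integral_near_cst (R : realType) (a b k eps : R) (f : R -> R) :
  a <= b -> segment_integrable a b f ->
  (forall x, a <= x -> x <= b -> `|f x - k| <= eps) ->
  `|segment_integral a b f - k * (b - a)| <= eps * (b - a).
Proof.
move=> ab itf fk; rewrite ler_distl -mulrBl -mulrDl -!segment_integral_cst//.
apply/andP; split; apply: le_segment_integral => //;
  try exact: segment_integrable_cst;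
  by move=> x ax xb; have := fk x ax xb; rewrite ler_distl => /andP[].
Qed.

(** * Cauchy's theorem for closed forms on rectangles *)

(** The form is u dx + v dy, differentiable at each point of the quadrant x >= A,
    y >= 0; the common coefficient q is the equality of u_y and v_x.  The points
    (x, y) stay in the quadrant, so that nothing is asked below the line y = 0. *)
Definition closed_form (R : realType) (A : R) (u v : R -> R -> R) : Prop :=
  forall x0 y0, A <= x0 -> 0 <= y0 -> exists p q r,
    forall eps, 0 < eps -> exists2 delta, 0 < delta &
    forall x y, A <= x -> 0 <= y -> `|x - x0| < delta -> `|y - y0| < delta ->
      `|u x y - (u x0 y0 + p * (x - x0) + q * (y - y0))|
         <= eps * (`|x - x0| + `|y - y0|) /\
      `|v x y - (v x0 y0 + q * (x - x0) + r * (y - y0))|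
         <= eps * (`|x - x0| + `|y - y0|).

Lemma affine_approx_close (R : realType) (eps p q dx dy c c0 : R) :
  0 < eps ->
  `|dx| < eps / (`|p| + `|q| + 2) / 2 -> `|dy| < eps / (`|p| + `|q| + 2) / 2 ->
  `|c - (c0 + p * dx + q * dy)| <= 1 * (`|dx| + `|dy|) ->
  `|c - c0| <= eps.
Proof.
move=> eps0 hx hy h.
have K0 : 0 < `|p| + `|q| + 2 by rewrite ltr_wpDl// addr_ge0.
have -> : c - c0 = (c - (c0 + p * dx + q * dy)) + (p * dx + q * dy) by ring.
apply: (le_trans (ler_normD _ _)); apply: (le_trans (lerD h (ler_normD _ _))).
rewrite !normrM mul1r.
set d := eps / _ / 2 in hx hy.
have d0 : 0 < d by rewrite /d !divr_gt0.
have -> : eps = d * 2 * (`|p| + `|q| + 2).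
  by rewrite /d divfK// divfK// gt_eqF.
have h1 : `|p| * `|dx| <= `|p| * d by rewrite ler_wpM2l// ltW.
have h2 : `|q| * `|dy| <= `|q| * d by rewrite ler_wpM2l// ltW.
have := normr_ge0 p; have := normr_ge0 q.
move: (`|p|) (`|q|) (`|dx|) (`|dy|) h1 h2 hx hy d0 => P Q X Y h1 h2 hx hy d0 Q0 P0.
have := mulr_ge0 P0 (ltW d0); have := mulr_ge0 Q0 (ltW d0).
nra.
Qed.

Lemma closed_form_continuous (R : realType) (A : R) (u v : R -> R -> R) :
  closed_form A u v -> forall x0 y0, A <= x0 -> 0 <= y0 ->
  forall eps, 0 < eps -> exists2 delta, 0 < delta &
    forall x y, A <= x -> 0 <= y -> `|x - x0| < delta -> `|y - y0| < delta ->
      `|u x y - u x0 y0| <= eps /\ `|v x y - v x0 y0| <= eps.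
Proof.
move=> cl x0 y0 Ax0 y00 eps eps0.
have [p [q [r H]]] := cl x0 y0 Ax0 y00.
have [d d0 dP] := H 1 ltr01.
have K1 : 0 < eps / (`|p| + `|q| + 2) / 2.
  by rewrite !divr_gt0// ltr_wpDl// addr_ge0.
have K2 : 0 < eps / (`|q| + `|r| + 2) / 2.
  by rewrite !divr_gt0// ltr_wpDl// addr_ge0.
exists (Num.min d
  (Num.min (eps / (`|p| + `|q| + 2) / 2) (eps / (`|q| + `|r| + 2) / 2))).
  by rewrite !lt_min d0 K1 K2.
move=> x y Ax yy; rewrite !lt_min => /andP[x1 /andP[x3 x4]].
move=> /andP[y1 /andP[y3 y4]].
have [h1 h2] := dP x y Ax yy x1 y1.
by split; [apply: (affine_approx_close _ x3 y3 h1)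
          |apply: (affine_approx_close _ x4 y4 h2)].
Qed.

Lemma closed_form_row_continuous (R : realType) (A y : R) (u v : R -> R -> R) :
  closed_form A u v -> 0 <= y -> half_line_continuous A (u^~ y).
Proof.
move=> cl y0 x0 Ax0 eps eps0.
have [d d0 dP] := closed_form_continuous cl Ax0 y0 eps0.
exists d => // x Ax xd.
by have [] := dP x y Ax y0 xd; rewrite ?subrr ?normr0.
Qed.

Lemma closed_form_column_continuous (R : realType) (A x : R) (u v : R -> R -> R) :
  closed_form A u v -> A <= x -> half_line_continuous 0 (v x).
Proof.
move=> cl Ax y0 y00 eps eps0.
have [d d0 dP] := closed_form_continuous cl Ax y00 eps0.
exists d => // y yy yd.
by have [] := dP x y Ax yy; rewrite ?subrr ?normr0.
Qed.

(** The integral of u dx + v dy along the boundary of a rectangle, the two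
    parallel sides being taken together: an affine form then needs no integral
    other than those of constants. *)
Definition boundary_integral (R : realType) (u v : R -> R -> R)
    (a b c d : R) : R :=
  segment_integral a b (fun x => u x c - u x d) +
  segment_integral c d (fun y => v b y - v a y).
Lemma boundary_integral_split_x (R : realType) (A a m b c d : R)
    (u v : R -> R -> R) :
  closed_form A u v -> A <= a -> a <= m -> m <= b -> 0 <= c -> c <= d ->
  boundary_integral u v a b c d =
  boundary_integral u v a m c d + boundary_integral u v m b c d.
Proof.
move=> cl Aa am mb c0 cd; rewrite /boundary_integral.
have cu y : 0 <= y -> segment_integrable a b (u^~ y).
  by move=> y0; exact: (half_line_continuous_integrable b
    (closed_form_row_continuous cl y0)).
have cv x : A <= x -> segment_integrable c d (v x).
  by move=> Ax; exact: (half_line_continuous_integrable d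
    (closed_form_column_continuous cl Ax)).
have Am := le_trans Aa am; have Ab := le_trans Am mb.
have d0 := le_trans c0 cd.
rewrite (segment_integral_split am mb); last first.
  by apply: segment_integrableB; exact: cu.
by rewrite !(segment_integralB (cv _ _) (cv _ _))//; lra.
Qed.

Lemma boundary_integral_split_y (R : realType) (A a b c m d : R)
    (u v : R -> R -> R) :
  closed_form A u v -> A <= a -> a <= b -> 0 <= c -> c <= m -> m <= d ->
  boundary_integral u v a b c d =
  boundary_integral u v a b c m + boundary_integral u v a b m d.
Proof.
move=> cl Aa ab c0 cm md; rewrite /boundary_integral.
have cu y : 0 <= y -> segment_integrable a b (u^~ y).
  by move=> y0; exact: (half_line_continuous_integrable b
    (closed_form_row_continuous cl y0)).
have cv x : A <= x -> segment_integrable c d (v x).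
  by move=> Ax; exact: (half_line_continuous_integrable d
    (closed_form_column_continuous cl Ax)).
have Ab := le_trans Aa ab; have m0 := le_trans c0 cm; have d0 := le_trans m0 md.
rewrite (segment_integral_split cm md); last first.
  by apply: segment_integrableB; exact: cv.
by rewrite !(segment_integralB (cu _ _) (cu _ _))//; lra.
Qed.

(** The boundary integrals over the four quarters add up to the whole, so one of
    them carries at least a fourth of it. *)
Lemma boundary_integral_quarter (R : realType) (A a c l h : R)
    (u v : R -> R -> R) :
  closed_form A u v -> A <= a -> 0 <= c -> 0 <= l -> 0 <= h ->
  exists a' c', [/\ a <= a', a' <= a + l, c <= c', c' <= c + h &
    `|boundary_integral u v a (a + (l + l)) c (c + (h + h))| <=
    4 * `|boundary_integral u v a' (a' + l) c' (c' + h)|].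
Proof.
move=> cl Aa c0 l0 h0.
have e1 : boundary_integral u v a (a + (l + l)) c (c + (h + h)) =
  boundary_integral u v a (a + l) c (c + h) +
  boundary_integral u v (a + l) (a + l + l) c (c + h) +
  (boundary_integral u v a (a + l) (c + h) (c + h + h) +
   boundary_integral u v (a + l) (a + l + l) (c + h) (c + h + h)).
  have ch : c <= c + h by rewrite lerDl.
  have chh : c + h <= c + h + h by rewrite lerDl.
  have al : a <= a + l by rewrite lerDl.
  have all : a + l <= a + l + l by rewrite lerDl.
  rewrite !addrA (boundary_integral_split_y cl Aa (le_trans al all) c0 ch chh).
  rewrite (boundary_integral_split_x cl Aa al all c0 ch).
  by rewrite (boundary_integral_split_x cl Aa al all (le_trans c0 ch) chh) !addrA.
rewrite {}e1.
set b1 := boundary_integral u v a (a + l) c (c + h).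
set b2 := boundary_integral u v (a + l) _ c _.
set b3 := boundary_integral u v a _ (c + h) _.
set b4 := boundary_integral u v (a + l) _ (c + h) _.
have le4 : `|b1 + b2 + (b3 + b4)| <= `|b1| + `|b2| + (`|b3| + `|b4|).
  by rewrite (le_trans (ler_normD _ _))// lerD// ler_normD.
set T := `|b1 + _ + _| in le4 *.
case: (leP T (4 * `|b1|)) => H1; first by exists a, c; split=> //; lra.
case: (leP T (4 * `|b2|)) => H2; first by exists (a + l), c; split=> //; lra.
case: (leP T (4 * `|b3|)) => H3; first by exists a, (c + h); split=> //; lra.
by exists (a + l), (c + h); split=> //; lra.
Qed.

Lemma nested_segments (R : realType) (a b : nat -> R) :
  (forall n, a n <= a n.+1) -> (forall n, b n.+1 <= b n) ->
  (forall n, a n <= b n) -> exists x, forall n, a n <= x /\ x <= b n.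
Proof.
move=> inca decb ab.
have leab m n : a m <= b n.
  apply: (@le_trans _ _ (a (maxn m n))).
    by move/nondecreasing_seqP: inca; apply; exact: leq_maxl.
  apply: (le_trans (ab _)).
  by move/nonincreasing_seqP: decb; apply; exact: leq_maxr.
exists (sup (range a)) => n; split.
  apply: sup_upper_bound; last by exists n.
  split; first by exists (a 0%N); exists 0%N.
  by exists (b 0%N) => _ [m _ <-].
apply: ge_sup; first by exists (a 0%N); exists 0%N.
by move=> _ [m _ <-].
Qed.

(** P n a c speaks of the box with corner (a, c) and sides l n and h n.  Choosing
    boxes one inside the other gives a common point of all of them. *)
Lemma nested_boxes (R : realType) (a0 c0 : R) (l h : nat -> R)
    (P : nat -> R -> R -> Prop) :
  (forall n, 0 <= l n) -> (forall n, 0 <= h n) -> P 0%N a0 c0 ->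
  (forall n a c, P n a c -> exists a' c',
    [/\ a <= a', a' + l n.+1 <= a + l n, c <= c', c' + h n.+1 <= c + h n &
        P n.+1 a' c']) ->
  exists x y, forall n, exists a c,
    [/\ P n a c, a <= x, x <= a + l n, c <= y & y <= c + h n].
Proof.
move=> l0 h0 P0 step.
have step' : forall nq : nat * (R * R), exists q' : R * R,
    P nq.1 nq.2.1 nq.2.2 ->
    [/\ nq.2.1 <= q'.1, q'.1 + l nq.1.+1 <= nq.2.1 + l nq.1, nq.2.2 <= q'.2,
        q'.2 + h nq.1.+1 <= nq.2.2 + h nq.1 & P nq.1.+1 q'.1 q'.2].
  move=> [n [a c]] /=; case: (pselect (P n a c)) => [Pn|]; last by exists (0, 0).
  by have [a' [c' H]] := step n a c Pn; exists (a', c').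
have [f fP] := choice step'.
pose s := fix s n := if n is m.+1 then f (m, s m) else (a0, c0).
have sP n : P n (s n).1 (s n).2.
  by elim: n => [//|n IH]; have [] := fP (n, s n) IH.
have sS n := fP (n, s n) (sP n).
have [x xP] := @nested_segments R (fun n => (s n).1) (fun n => (s n).1 + l n)
  ltac:(by move=> n; case: (sS n)) ltac:(by move=> n; case: (sS n))
  ltac:(by move=> n; rewrite lerDl).
have [y yP] := @nested_segments R (fun n => (s n).2) (fun n => (s n).2 + h n)
  ltac:(by move=> n; case: (sS n)) ltac:(by move=> n; case: (sS n))
  ltac:(by move=> n; rewrite lerDl).
exists x, y => n; exists (s n).1, (s n).2.
by have [? ?] := xP n; have [? ?] := yP n.
Qed.

(** The affine part of a closed form has zero integral around a rectangle, and
    the remainder is o(l + h) on sides of total length O(l + h). *)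
Lemma boundary_integral_local (R : realType) (A x0 y0 eps : R)
    (u v : R -> R -> R) :
  closed_form A u v -> A <= x0 -> 0 <= y0 -> 0 < eps ->
  exists2 delta, 0 < delta & forall a c l h,
    A <= a -> 0 <= c -> 0 <= l -> 0 <= h -> l < delta -> h < delta ->
    a <= x0 -> x0 <= a + l -> c <= y0 -> y0 <= c + h ->
    `|boundary_integral u v a (a + l) c (c + h)| <= 2 * eps * (l + h) ^+ 2.
Proof.
move=> cl Ax0 y00 eps0; have [p [q [r H]]] := cl x0 y0 Ax0 y00.
have [d d0 dP] := H eps eps0; exists d => // a c l h Aa c0 l0 h0 ld hd ax xa cy yc.
have near x y : a <= x -> x <= a + l -> c <= y -> y <= c + h ->
  `|u x y - (u x0 y0 + p * (x - x0) + q * (y - y0))| <= eps * (l + h) /\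
  `|v x y - (v x0 y0 + q * (x - x0) + r * (y - y0))| <= eps * (l + h).
  move=> x1 x2 y1 y2.
  have xl : `|x - x0| <= l by rewrite ler_distl; apply/andP; split; lra.
  have yh : `|y - y0| <= h by rewrite ler_distl; apply/andP; split; lra.
  have [] := dP x y (le_trans Aa x1) (le_trans c0 y1)
    (le_lt_trans xl ld) (le_lt_trans yh hd).
  have le1 : eps * (`|x - x0| + `|y - y0|) <= eps * (l + h).
    by apply: ler_wpM2l; [exact: ltW|exact: lerD].
  by move=> h1 h2; split; apply: le_trans le1.
have cu y : 0 <= y -> segment_integrable a (a + l) (u^~ y).
  by move=> yy0; exact: (half_line_continuous_integrable _
    (closed_form_row_continuous cl yy0)).
have cv x : A <= x -> segment_integrable c (c + h) (v x).
  by move=> Ax; exact: (half_line_continuous_integrable _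
    (closed_form_column_continuous cl Ax)).
have al : a <= a + l by rewrite lerDl.
have ch : c <= c + h by rewrite lerDl.
rewrite /boundary_integral.
set I1 := segment_integral _ _ _; set I2 := segment_integral _ _ _.
have b1 : `|I1 - (- (q * h)) * (a + l - a)| <= 2 * eps * (l + h) * (a + l - a).
  apply: segment_integral_near_cst => //.
    by apply: segment_integrableB; apply: cu; lra.
  move=> x x1 x2.
  have [/ler_normlP[]h1 h2 _] := near x c x1 x2 (lexx _) ch.
  have [/ler_normlP[]h3 h4 _] := near x (c + h) x1 x2 ch (lexx _).
  apply/ler_normlP; split; lra.
have b2 : `|I2 - q * l * (c + h - c)| <= 2 * eps * (l + h) * (c + h - c).
  apply: segment_integral_near_cst => //.
    by apply: segment_integrableB; apply: cv; lra.
  move=> y y1 y2.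
  have [_ /ler_normlP[]h1 h2] := near (a + l) y al (lexx _) y1 y2.
  have [_ /ler_normlP[]h3 h4] := near a y (lexx _) al y1 y2.
  apply/ler_normlP; split; lra.
move: b1 b2 => /ler_normlP[h1 h2] /ler_normlP[h3 h4].
apply/ler_normlP; split; nra.
Qed.

Lemma exists_half_power_lt (R : realType) (l delta : R) :
  0 < delta -> exists n, l / 2 ^+ n < delta.
Proof.
move=> d0; exists (Num.bound (l / delta)).
rewrite ltr_pdivrMr ?exprn_gt0// mulrC -ltr_pdivrMr//.
exact: upper_nthrootP.
Qed.

(** Bisecting n times divides the boundary integral by at most 4^n, while the
    local estimate at the limit point divides it by 4^n and an arbitrary
    constant. *)
Lemma goursat_rectangle (R : realType) (A a b c d : R) (u v : R -> R -> R) :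
  closed_form A u v -> A <= a -> a <= b -> 0 <= c -> c <= d ->
  boundary_integral u v a b c d = 0.
Proof.
move=> cl Aa ab c0 cd.
pose l n := (b - a) / 2 ^+ n; pose h n := (d - c) / 2 ^+ n.
have l0 n : 0 <= l n by rewrite divr_ge0 ?exprn_ge0// subr_ge0.
have h0 n : 0 <= h n by rewrite divr_ge0 ?exprn_ge0// subr_ge0.
have half (k : R) n : k / 2 ^+ n = k / 2 ^+ n.+1 + k / 2 ^+ n.+1.
  by rewrite exprS -mulrDl; field; rewrite expf_neq0.
have lS n : l n = l n.+1 + l n.+1 by exact: half.
have hS n : h n = h n.+1 + h n.+1 by exact: half.
pose J := boundary_integral u v a b c d.
pose P n a' c' := [/\ A <= a', 0 <= c' &
  `|J| <= 4 ^+ n * `|boundary_integral u v a' (a' + l n) c' (c' + h n)|].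
have P0 : P 0%N a c.
  split=> //; rewrite expr0 mul1r /l /h expr0 !divr1 !(addrC _ (_ - _)) !subrK.
  exact: lexx.
have step n a' c' : P n a' c' -> exists a'' c'',
    [/\ a' <= a'', a'' + l n.+1 <= a' + l n, c' <= c'',
        c'' + h n.+1 <= c' + h n & P n.+1 a'' c''].
  move=> [Aa' c0' bJ].
  have [a'' [c'' [a1 a2 c1 c2 bq]]] :=
    boundary_integral_quarter cl Aa' c0' (l0 n.+1) (h0 n.+1).
  exists a'', c''; split=> //; first by rewrite (lS n); lra.
    by rewrite (hS n); lra.
  split; [exact: le_trans a1|exact: le_trans c1|].
  apply: (le_trans bJ); rewrite (lS n) (hS n) exprS.
  by rewrite -mulrA mulrCA ler_wpM2l ?exprn_ge0.
have [x [y xyP]] := nested_boxes l0 h0 P0 step.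
have [Ax y0] : A <= x /\ 0 <= y.
  have [a' [c' [[Aa' c0' _] ax _ cy _]]] := xyP 0%N.
  by split; [exact: le_trans ax|exact: le_trans cy].
suff small eps : 0 < eps -> `|J| <= 2 * eps * (b - a + (d - c)) ^+ 2.
  apply/eqP; rewrite -normr_eq0 -/J eq_le normr_ge0 andbT.
  set K := (b - a + (d - c)) ^+ 2 in small.
  have K0 : 0 <= K by exact: sqr_ge0.
  rewrite leNgt; apply/negP => J0.
  have := small (`|J| / (2 * (K + 1)) / 2).
  have KK : 0 < 2 * (K + 1) by lra.
  rewrite !divr_gt0// => /(_ isT).
  have -> : 2 * (`|J| / (2 * (K + 1)) / 2) * K = `|J| * (K / (2 * (K + 1))).
    by field; rewrite gt_eqF//; lra.
  rewrite ler_pMr// ler_pdivlMr//; lra.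
move=> eps0; have [dl dl0 dlP] := boundary_integral_local cl Ax y0 eps0.
have [n nP] := exists_half_power_lt (b - a + (d - c)) dl0.
have [a' [c' [[Aa' c0' bJ] ax xa cy yc]]] := xyP n.
have lh : l n + h n = (b - a + (d - c)) / 2 ^+ n by rewrite -mulrDl.
have := dlP a' c' (l n) (h n) Aa' c0' (l0 n) (h0 n).
have ll : l n < dl by apply: le_lt_trans nP; rewrite -lh lerDl.
have hh : h n < dl by apply: le_lt_trans nP; rewrite -lh lerDr.
move=> /(_ ll hh ax xa cy yc) H.
apply: (le_trans bJ); have q0 : 0 <= 4 ^+ n :> R by rewrite exprn_ge0.
apply: (le_trans (ler_wpM2l q0 H)); rewrite lh.
have -> : 4 ^+ n = 2 ^+ n * 2 ^+ n :> R by rewrite -exprMn; congr (_ ^+ _); ring.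
by rewrite le_eqVlt; apply/orP; left; apply/eqP; field; rewrite expf_neq0.
Qed.
(** * Primitives of closed forms *)

Definition primitive (R : realType) (A : R) (u v : R -> R -> R) (x y : R) : R :=
  segment_integral A x (u^~ 0) + segment_integral 0 y (v x).

(** Independence of the path, from Cauchy's theorem on [x1, x2] x [0, y]. *)
Lemma primitive_row (R : realType) (A x1 x2 y : R) (u v : R -> R -> R) :
  closed_form A u v -> A <= x1 -> x1 <= x2 -> 0 <= y ->
  primitive A u v x2 y - primitive A u v x1 y = segment_integral x1 x2 (u^~ y).
Proof.
move=> cl A1 x12 y0; rewrite /primitive.
have cu a b z : A <= a -> 0 <= z -> segment_integrable a b (u^~ z).
  by move=> Aa z0; exact: (half_line_continuous_integrable b
    (closed_form_row_continuous cl z0)).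
have cv x : A <= x -> segment_integrable 0 y (v x).
  by move=> Ax; exact: (half_line_continuous_integrable y
    (closed_form_column_continuous cl Ax)).
have := goursat_rectangle cl A1 x12 (lexx 0) y0.
rewrite /boundary_integral !segment_integralB//; first last.
- exact: cu.
- exact: cu.
- exact: cv.
- exact/cv/(le_trans A1).
by rewrite (segment_integral_split A1 x12); [move=> H; lra|exact: cu].
Qed.

Lemma primitive_column (R : realType) (A x y1 y2 : R) (u v : R -> R -> R) :
  closed_form A u v -> A <= x -> 0 <= y1 -> y1 <= y2 ->
  primitive A u v x y2 - primitive A u v x y1 = segment_integral y1 y2 (v x).
Proof.
move=> cl Ax y10 y12; rewrite /primitive.
rewrite (segment_integral_split y10 y12); first by lra.
exact: (half_line_continuous_integrable _ (closed_form_column_continuous cl Ax)).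
Qed.

(** Moving horizontally and then vertically, the increments of the primitive are
    integrals of the nearly constant coefficients. *)
Lemma primitive_gradient (R : realType) (A x0 y0 : R) (u v : R -> R -> R) :
  closed_form A u v -> A <= x0 -> 0 <= y0 -> forall eps, 0 < eps ->
  exists2 delta, 0 < delta &
    forall x y, A <= x -> 0 <= y -> `|x - x0| < delta -> `|y - y0| < delta ->
    `|primitive A u v x y -
        (primitive A u v x0 y0 + u x0 y0 * (x - x0) + v x0 y0 * (y - y0))|
      <= eps * (`|x - x0| + `|y - y0|).
Proof.
move=> cl Ax0 y00 eps eps0.
have [d d0 dP] := closed_form_continuous cl Ax0 y00 eps0.
exists d => // x y Ax yy xd yd.
have hrow : `|primitive A u v x y - primitive A u v x0 y - u x0 y0 * (x - x0)|
    <= eps * `|x - x0|.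
  have itu a b : A <= a -> segment_integrable a b (u^~ y).
    by move=> Aa; exact: (half_line_continuous_integrable b
      (closed_form_row_continuous cl yy)).
  have near t : A <= t -> `|t - x0| < d -> `|u t y - u x0 y0| <= eps.
    by move=> At td; have [] := dP t y At yy td yd.
  case: (leP x0 x) => [xx|/ltW xx].
    rewrite (primitive_row cl)// (ger0_norm (x := x - x0)) ?subr_ge0//.
    apply: segment_integral_near_cst => //; first exact: itu.
    move=> t t1 t2; apply: near; first exact: le_trans t1.
    apply: le_lt_trans xd; rewrite !ger0_norm ?subr_ge0//; first exact: lerB.
  rewrite [X in `|X| <= _](_ : _ = - (primitive A u v x0 y -
    primitive A u v x y - u x0 y0 * (x0 - x))); last by ring.
  rewrite normrN (primitive_row cl)//.
  rewrite (ler0_norm (x := x - x0)) ?subr_le0// opprB.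
  apply: segment_integral_near_cst => //; first exact: itu.
  move=> t t1 t2; apply: near; first exact: le_trans t1.
  apply: le_lt_trans xd; rewrite !ler0_norm ?subr_le0//; lra.
have hcol : `|primitive A u v x0 y - primitive A u v x0 y0 - v x0 y0 * (y - y0)|
    <= eps * `|y - y0|.
  have itv a b : 0 <= a -> segment_integrable a b (v x0).
    by move=> a0; exact: (half_line_continuous_integrable b
      (closed_form_column_continuous cl Ax0)).
  have near t : 0 <= t -> `|t - y0| < d -> `|v x0 t - v x0 y0| <= eps.
    move=> t0 td; have [] := dP x0 t Ax0 t0 _ td => //.
    by rewrite subrr normr0.
  case: (leP y0 y) => [xx|/ltW xx].
    rewrite (primitive_column cl)// (ger0_norm (x := y - y0)) ?subr_ge0//.
    apply: segment_integral_near_cst => //; first exact: itv.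
    move=> t t1 t2; apply: near; first exact: le_trans t1.
    apply: le_lt_trans yd; rewrite !ger0_norm ?subr_ge0//; first exact: lerB.
  rewrite [X in `|X| <= _](_ : _ = - (primitive A u v x0 y0 -
    primitive A u v x0 y - v x0 y0 * (y0 - y))); last by ring.
  rewrite normrN (primitive_column cl)//.
  rewrite (ler0_norm (x := y - y0)) ?subr_le0// opprB.
  apply: segment_integral_near_cst => //; first exact: itv.
  move=> t t1 t2; apply: near; first exact: le_trans t1.
  apply: le_lt_trans yd; rewrite !ler0_norm ?subr_le0//; lra.
rewrite [X in _ <= X]mulrDr; apply: (le_trans _ (lerD hrow hcol)).
apply: (le_trans _ (ler_normD _ _)); rewrite le_eqVlt; apply/orP; left; apply/eqP.
by congr `|_|; ring.
Qed.

(** The two hypotheses say that F = v + i u is holomorphic; the two primitives are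
    then the imaginary and the real part of a holomorphic primitive of F, and
    Cauchy's theorem applies to that primitive in turn. *)
Lemma closed_form_primitives (R : realType) (A : R) (u v : R -> R -> R) :
  closed_form A u v -> closed_form A v (fun x y => - u x y) ->
  closed_form A (primitive A u v) (primitive A v (fun x y => - u x y)).
Proof.
move=> cl1 cl2 x0 y0 Ax0 y00; exists (u x0 y0), (v x0 y0), (- u x0 y0).
move=> eps eps0.
have [d1 d10 d1P] := primitive_gradient cl1 Ax0 y00 eps0.
have [d2 d20 d2P] := primitive_gradient cl2 Ax0 y00 eps0.
exists (Num.min d1 d2); first by rewrite lt_min d10.
move=> x y Ax yy; rewrite !lt_min => /andP[? ?] /andP[? ?].
by split; [exact: d1P|exact: d2P].
Qed.

(** * Functions with weighted square-integrable horizontal restrictions *)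

Lemma half_line_continuous_measurable (R : realType) (f : R -> R) :
  (forall A, half_line_continuous A f) -> measurable_fun setT f.
Proof.
move=> cf; apply: continuous_measurable_fun => x.
apply/cvgrPdist_le => eps eps0.
have x1 : x - 1 <= x by lra.
have [d d0 dP] := cf (x - 1) x x1 eps eps0.
have d10 : 0 < Num.min d 1 by rewrite lt_min d0 ltr01.
apply: filterS (nbhsx_ballx x (Num.min d 1) d10) => y /= yd.
rewrite /ball/= lt_min in yd; case/andP: yd => yd y1.
rewrite distrC; apply: dP; last by rewrite distrC.
by move: y1; rewrite ltr_distl => /andP[]; lra.
Qed.

Lemma segment_integral_le_mass (R : realType) (a b al be M : R) (f g : R -> R) :
  a <= b -> 0 <= al -> 0 <= be -> segment_integrable a b f ->
  measurable_fun setT g -> (forall x, 0 <= g x) ->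
  (\int[@lebesgue_measure R]_(x in setT) (g x)%:E <= M%:E)%E ->
  (forall x, a <= x -> x <= b -> `|f x| <= al + be * g x) ->
  `|segment_integral a b f| <= al * (b - a) + be * M.
Proof.
move=> ab al0 be0 itf mg g0 gM fg.
have mgs : measurable_fun `[a, b] (EFin \o g).
  by apply/measurable_EFinP/measurable_funTS.
rewrite -lee_fin; apply: (@le_trans _ _ (\int[@lebesgue_measure R]_(x in `[a, b]) `|f x|%:E)%E).
  apply: (le_trans _ (le_abse_integral (@lebesgue_measure R) _ (measurable_int _ itf))) => //.
  rewrite -(@fineK _ (integral _ _ _)); last exact: integrable_fin_num.
  by rewrite abse_EFin.
apply: (@le_trans _ _ (\int[@lebesgue_measure R]_(x in `[a, b]) (al%:E + be%:E * (g x)%:E))%E).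
  apply: ge0_le_integral => //.
  - do 2 apply: measurableT_comp => //; apply/measurable_EFinP.
    exact: measurable_int itf.
  - by apply: emeasurable_funD => //; exact: measurable_funeM.
  - move=> x /=; rewrite in_itv/= => /andP[x1 x2].
    by rewrite -EFinM -EFinD lee_fin fg.
rewrite ge0_integralD//; last 2 first.
  by move=> x _; rewrite -EFinM lee_fin mulr_ge0.
  exact: measurable_funeM.
rewrite EFinD; apply: leeD.
  rewrite integral_cst// EFinM.
  have := @lebesgue_measure_itv R `[a, b]; rewrite /= => ->.
  move: ab; rewrite le_eqVlt => /predU1P[->|ab]; first by rewrite ltxx subrr.
  by rewrite lte_fin ab -EFinB.
rewrite ge0_integralZl//; last by move=> x _; rewrite lee_fin.
rewrite EFinM; apply: lee_wpmul2l; first by rewrite lee_fin.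
apply: le_trans gM; apply: ge0_subset_integral => //; first exact/measurable_EFinP.
by move=> x _; rewrite lee_fin.
Qed.

(** The inequality of arithmetic and geometric means
    |f| <= lam / 2 + f^2 / (2 lam), in place of the Cauchy-Schwarz inequality. *)
Lemma segment_integral_weighted (R : realType) (a b y lam k M : R)
    (f g : R -> R) :
  a <= b -> 0 < lam -> 0 < k -> segment_integrable a b f ->
  measurable_fun setT g -> (forall x, 0 <= g x) ->
  (\int[@lebesgue_measure R]_(x in setT) (g x)%:E <= M%:E)%E ->
  (forall x, (1 + x ^+ 2 + y ^+ 2) * f x ^+ 2 <= g x) ->
  (forall x, a <= x -> x <= b -> k <= 1 + x ^+ 2 + y ^+ 2) ->
  `|segment_integral a b f| <= lam / 2 * (b - a) + (2 * lam * k)^-1 * M.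
Proof.
move=> ab lam0 k0 itf mg g0 gM fg kx.
have lk0 : 0 < 2 * lam * k by rewrite !mulr_gt0.
apply: (segment_integral_le_mass (g := g)) => //.
- by rewrite divr_ge0// ltW.
- by rewrite invr_ge0 ltW.
move=> x ax xb.
have -> : lam / 2 + (2 * lam * k)^-1 * g x
    = (lam ^+ 2 * k + g x) / (2 * lam * k).
  by field; rewrite !gt_eqF.
rewrite ler_pdivlMr//.
have h1 : k * f x ^+ 2 <= g x.
  by apply: (le_trans _ (fg x)); apply: ler_wpM2r; [exact: sqr_ge0|exact: kx].
have : 0 <= k * (lam - `|f x|) ^+ 2 by rewrite mulr_ge0 ?sqr_ge0// ltW.
have : `|f x| ^+ 2 = f x ^+ 2 by rewrite real_normK// num_real.
move: (`|f x|) (g x) (f x ^+ 2) h1 => F G S; nra.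
Qed.

(** With F = V + i U, the function q + i p is a holomorphic primitive of F.
    Where the horizontal integrals of F are small, p and q barely vary over a
    horizontal unit; in Cauchy's theorem for p dx + q dy on the box
    [a, a + 1] x [0, Y] the vertical sides then cancel up to Y tau, and the
    horizontal ones give p(a, 0) - p(a, Y) up to 2 tau. *)
Lemma primitive_vertical_increment (R : realType) (A a Y tau : R)
    (U V : R -> R -> R) :
  closed_form A U V -> closed_form A V (fun x y => - U x y) ->
  A <= a -> 0 <= Y ->
  (forall x y, a <= x -> x <= a + 1 -> 0 <= y ->
    `|segment_integral a x (U^~ y)| <= tau /\
    `|segment_integral a x (V^~ y)| <= tau) ->
  `|primitive A U V a 0 - primitive A U V a Y| <= (2 + Y) * tau.
Proof.
move=> clU clV Aa Y0 small.
set p := primitive A U V; set q := primitive A V (fun x y => - U x y).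
have clp : closed_form A p q by exact: closed_form_primitives.
have a1 : a <= a + 1 by rewrite lerDl.
have itp y : 0 <= y -> segment_integrable a (a + 1) (p^~ y).
  by move=> y0; exact: (half_line_continuous_integrable _
    (closed_form_row_continuous clp y0)).
have itq x : A <= x -> segment_integrable 0 Y (q x).
  by move=> y0; exact: (half_line_continuous_integrable _
    (closed_form_column_continuous clp y0)).
have := goursat_rectangle clp Aa a1 (lexx 0) Y0.
rewrite /boundary_integral.
set I1 := segment_integral _ _ _; set I2 := segment_integral _ _ _ => I12.
have b1 : `|I1 - (p a 0 - p a Y) * (a + 1 - a)| <= (2 * tau) * (a + 1 - a).
  apply: segment_integral_near_cst => //.
    by apply: segment_integrableB; exact: itp.
  move=> x x1 x2.
  have [h1 _] := small x 0 x1 x2 (lexx 0); have [h2 _] := small x Y x1 x2 Y0.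
  rewrite -(primitive_row clU) -/p// in h1; rewrite -(primitive_row clU) -/p// in h2.
  move: h1 h2 => /ler_normlP[h1 h2] /ler_normlP[h3 h4].
  by apply/ler_normlP; split; lra.
have b2 : `|I2 - 0 * (Y - 0)| <= tau * (Y - 0).
  apply: segment_integral_near_cst => //.
    by apply: segment_integrableB; apply: itq; lra.
  move=> y y1 y2; rewrite subr0 /q (primitive_row clV)//.
  by have [] := small (a + 1) y a1 (lexx _) y1.
move: b1 b2 => /ler_normlP[h1 h2] /ler_normlP[h3 h4].
by apply/ler_normlP; split; lra.
Qed.

(** Height 0 is compared with height t^3 on the segment between the abscissas
    -t^4 - 1 and t^4.  The two vertical increments are O(Y / b) = O(1/t).  On the
    upper side |F|^2 has integral O(Y^-2), so |F| has integral
    O(b^(1/2) / Y) = O(1/t). *)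
Lemma segment_integral_boundary_bound (R : realType) (M t : R)
    (U V : R -> R -> R) :
  (forall A, closed_form A U V) ->
  (forall A, closed_form A V (fun x y => - U x y)) ->
  (forall y, 0 <= y -> (\int[@lebesgue_measure R]_(x in setT)
     ((1 + x ^+ 2 + y ^+ 2) * (U x y ^+ 2 + V x y ^+ 2))%:E <= M%:E)%E) ->
  1 <= t ->
  `|segment_integral (- t ^+ 4 - 1) (t ^+ 4) (U^~ 0)| <= (6 + 4 * M) / t.
Proof.
move=> clU clV mass t1.
pose g y x := (1 + x ^+ 2 + y ^+ 2) * (U x y ^+ 2 + V x y ^+ 2).
have w0 (x y : R) : 0 <= 1 + x ^+ 2 + y ^+ 2 by rewrite !addr_ge0// sqr_ge0.
have g0 y x : 0 <= g y x by rewrite mulr_ge0// addr_ge0// sqr_ge0.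
have mU y : 0 <= y -> measurable_fun setT (U^~ y).
  move=> y0; apply: half_line_continuous_measurable => A.
  exact: closed_form_row_continuous (clU A) y0.
have mV y : 0 <= y -> measurable_fun setT (V^~ y).
  move=> y0; apply: half_line_continuous_measurable => A.
  exact: closed_form_row_continuous (clV A) y0.
have mg y : 0 <= y -> measurable_fun setT (g y).
  move=> y0; apply: measurable_funM.
    by apply: measurable_funD => //; apply: measurable_funD => //.
  by apply: measurable_funD; apply: measurable_funX; [exact: mU|exact: mV].
have fU y x : (1 + x ^+ 2 + y ^+ 2) * U x y ^+ 2 <= g y x.
  by apply: ler_wpM2l => //; rewrite lerDl sqr_ge0.
have fV y x : (1 + x ^+ 2 + y ^+ 2) * V x y ^+ 2 <= g y x.
  by apply: ler_wpM2l => //; rewrite lerDr sqr_ge0.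
have M0 : 0 <= M.
  rewrite -lee_fin; apply: le_trans (mass 0 (lexx 0)).
  by apply: integral_ge0 => x _; rewrite lee_fin; exact: g0.
have itU a b y : 0 <= y -> segment_integrable a b (U^~ y).
  by move=> y0; exact: (half_line_continuous_integrable b
    (closed_form_row_continuous (clU a) y0)).
have itV a b y : 0 <= y -> segment_integrable a b (V^~ y).
  by move=> y0; exact: (half_line_continuous_integrable b
    (closed_form_row_continuous (clV a) y0)).
have t0 : 0 < t by lra.
set b := t ^+ 4; set Y := t ^+ 3.
have b0 : 0 < b by exact: exprn_gt0.
have Y0 : 0 < Y by exact: exprn_gt0.
have Yt : t * Y = b by rewrite /b exprS.
pose tau := (1 + M) / (2 * b).
have tau0 : 0 <= tau by rewrite divr_ge0 ?mulr_ge0 ?addr_ge0// ltW.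
(* On a segment of length at most one where |x| >= b, take lam = 1/b. *)
have window a x y : (forall z, a <= z -> z <= x -> b ^+ 2 <= z ^+ 2) ->
    a <= x -> x <= a + 1 -> 0 <= y ->
    `|segment_integral a x (U^~ y)| <= tau /\
    `|segment_integral a x (V^~ y)| <= tau.
  move=> far ax xa y0.
  have lam0 : 0 < b^-1 by rewrite invr_gt0.
  have k0 : 0 < b ^+ 2 by rewrite exprn_gt0.
  have kx z : a <= z -> z <= x -> b ^+ 2 <= 1 + z ^+ 2 + y ^+ 2.
    by move=> z1 z2; have := far z z1 z2; have := sqr_ge0 y; lra.
  have taub : b^-1 / 2 * (x - a) + (2 * b^-1 * b ^+ 2)^-1 * M <= tau.
    have -> : tau = b^-1 / 2 * 1 + (2 * b^-1 * b ^+ 2)^-1 * M.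
      by rewrite /tau; field; rewrite gt_eqF.
    by rewrite lerD2r ler_wpM2l ?divr_ge0 ?(ltW lam0)//; lra.
  split; apply: (le_trans _ taub).
    exact: (segment_integral_weighted ax lam0 k0 (itU _ _ _ y0) (mg _ y0)
      (g0 y) (mass y y0) (fU y) kx).
  exact: (segment_integral_weighted ax lam0 k0 (itV _ _ _ y0) (mg _ y0)
    (g0 y) (mass y y0) (fV y) kx).
pose A := - b - 1.
have right : `|primitive A U V b 0 - primitive A U V b Y| <= (2 + Y) * tau.
  apply: primitive_vertical_increment => //; [by rewrite /A; lra|exact: ltW|].
  move=> x y bx xb y0; apply: window => // z bz _.
  by rewrite ler_sqr ?nnegrE ?(ltW b0)// (le_trans (ltW b0)).
have left : `|primitive A U V A 0 - primitive A U V A Y| <= (2 + Y) * tau.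
  apply: primitive_vertical_increment => //; [exact: ltW|].
  move=> x y bx xb y0; apply: window => // z bz zx.
  rewrite -(sqrrN z) ler_sqr ?nnegrE ?(ltW b0)//; rewrite /A in xb; lra.
have Ab : A <= b by rewrite /A; lra.
have top : `|segment_integral A b (U^~ Y)| <= (3 + M) / (2 * t).
  have lam0 : 0 < (t * b)^-1 by rewrite invr_gt0 mulr_gt0.
  have k0 : 0 < Y ^+ 2 by rewrite exprn_gt0.
  apply: (le_trans (segment_integral_weighted Ab lam0 k0 (itU _ _ _ (ltW Y0))
    (mg _ (ltW Y0)) (g0 Y) (mass Y (ltW Y0)) (fU Y) _)).
    by move=> z _ _; have := sqr_ge0 z; lra.
  have -> : (2 * (t * b)^-1 * Y ^+ 2)^-1 * M = M / (2 * t).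
    by rewrite /b /Y; field; rewrite gt_eqF.
  rewrite [X in _ <= X]mulrDl lerD2r.
  have -> : 3 / (2 * t) = (t * b)^-1 / 2 * (3 * b).
    by field; rewrite !gt_eqF.
  rewrite ler_wpM2l ?divr_ge0 ?(ltW lam0)// /A.
  have : 1 <= b by rewrite /b exprn_ege1.
  lra.
have side : (2 + Y) * tau <= 3 * (1 + M) / (2 * t).
  have -> : 3 * (1 + M) / (2 * t) = 3 * Y * tau.
    by rewrite /tau -Yt; field; rewrite !gt_eqF.
  rewrite ler_wpM2r//.
  have : 1 <= Y by rewrite /Y exprn_ege1.
  lra.
have := primitive_row (clU A) (lexx A) Ab (lexx 0).
have := primitive_row (clU A) (lexx A) Ab (ltW Y0).
move=> eY e0; rewrite -eY in top; rewrite -/A -e0.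
have -> : (6 + 4 * M) / t = (3 + M) / (2 * t) + 3 * (1 + M) / (2 * t)
   + 3 * (1 + M) / (2 * t) + (3 + M) / (2 * t).
  by field; rewrite gt_eqF.
have : 0 <= (3 + M) / (2 * t) by rewrite divr_ge0 ?mulr_ge0 ?addr_ge0// ltW.
move: right left top => /ler_normlP[r1 r2] /ler_normlP[l1 l2] /ler_normlP[u1 u2].
by move=> pos; apply/ler_normlP; split; lra.
Qed.

Lemma integrable_inv_oneDsqr (R : realType) :
  (@lebesgue_measure R).-integrable setT (fun x => ((1 + x ^+ 2)^-1)%:E).
Proof.
have c : continuous (fun x : R => (1 + x ^+ 2)^-1) by exact: continuous_oneDsqrV.
have p (x : R) : 0 <= (1 + x ^+ 2)^-1 by rewrite invr_ge0 addr_ge0// sqr_ge0.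
apply/integrableP; split.
  by apply/measurable_EFinP; exact: continuous_measurable_fun.
under eq_integral => x _ do rewrite /= ger0_norm//.
rewrite ge0_symfun_integralT//; last by move=> x /=; rewrite sqrrN.
rewrite (_ : [set x | _] = `[0, +oo[%classic); last first.
  by apply/seteqP; split => x/=; rewrite in_itv/= andbT.
by rewrite integral0y_oneDsqr -EFinM ltry.
Qed.

(** The integrand is dominated by 1 / (1 + x^2) plus the weighted mass, so the
    integral is the limit of the integrals over the segments of the preceding
    bound. *)
Lemma boundary_integral_vanishes (R : realType) (M : R) (U V : R -> R -> R) :
  (forall A, closed_form A U V) ->
  (forall A, closed_form A V (fun x y => - U x y)) ->
  (forall y, 0 <= y -> (\int[@lebesgue_measure R]_(x in setT)
     ((1 + x ^+ 2 + y ^+ 2) * (U x y ^+ 2 + V x y ^+ 2))%:E <= M%:E)%E) ->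
  Rintegral (@lebesgue_measure R) setT (U^~ 0) = 0.
Proof.
move=> clU clV mass.
have mU : measurable_fun setT (U^~ 0).
  apply: half_line_continuous_measurable => A.
  exact: closed_form_row_continuous (clU A) (lexx 0).
have mV : measurable_fun setT (V^~ 0).
  apply: half_line_continuous_measurable => A.
  exact: closed_form_row_continuous (clV A) (lexx 0).
have M0 : 0 <= M.
  rewrite -lee_fin; apply: le_trans (mass 0 (lexx 0)).
  apply: integral_ge0 => x _; rewrite lee_fin.
  by rewrite mulr_ge0 ?addr_ge0// sqr_ge0.
pose g x := (1 + x ^+ 2 + 0 ^+ 2) * (U x 0 ^+ 2 + V x 0 ^+ 2).
have itg : (@lebesgue_measure R).-integrable setT (EFin \o g).
  apply/integrableP; split.
    apply/measurable_EFinP; apply: measurable_funM.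
      by apply: measurable_funD => //; apply: measurable_funD => //.
    by apply: measurable_funD; apply: measurable_funX.
  under eq_integral => x _.
    rewrite /= ger0_norm; last by rewrite /g mulr_ge0 ?addr_ge0// sqr_ge0.
    over.
  exact: le_lt_trans (mass 0 (lexx 0)) (ltry _).
have itU : (@lebesgue_measure R).-integrable setT (EFin \o U^~ 0).
  apply: (le_integrable _ _ _ (integrableD _ (integrable_inv_oneDsqr R) itg)) => //.
    exact/measurable_EFinP.
  move=> x _ /=; rewrite lee_fin.
  have w1 : 1 <= 1 + x ^+ 2 by rewrite lerDl sqr_ge0.
  have -> : g x = (1 + x ^+ 2) * (U x 0 ^+ 2 + V x 0 ^+ 2).
    by rewrite /g expr0n/= addr0.
  move: (1 + x ^+ 2) w1 => W W1; have W0 : 0 < W by lra.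
  have wi : 0 < W^-1 by rewrite invr_gt0.
  have WW : W * W^-1 = 1 by rewrite divff// gt_eqF.
  rewrite [X in _ <= X]ger0_norm; last by rewrite addr_ge0 ?mulr_ge0 ?addr_ge0 ?sqr_ge0 ?ltW.
  have : `|U x 0| ^+ 2 = U x 0 ^+ 2 by rewrite real_normK// num_real.
  have := sqr_ge0 (V x 0); have := normr_ge0 (U x 0).
  move: (`|U x 0|) (U x 0 ^+ 2) (V x 0 ^+ 2) => F S T F0 T0 FS.
  have : 0 <= W * (F - W^-1) ^+ 2 by rewrite mulr_ge0 ?sqr_ge0 ?ltW.
  have -> : W * (F - W^-1) ^+ 2 = W * F ^+ 2 - 2 * F * (W * W^-1) + W^-1 * (W * W^-1).
    by ring.
  rewrite WW; nra.
pose I n : set R := `[- n.+1%:R ^+ 4 - 1, n.+1%:R ^+ 4]%classic.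
pose f n := (fun x => (U x 0)%:E) \_ (I n).
have mf n : measurable_fun setT (f n).
  apply/(measurable_restrictT _ _).1; first exact: measurable_itv.
  by apply/measurable_EFinP; exact: measurable_funTS.
have f_le n x : (`|f n x| <= `|U x 0|%:E)%E.
  by rewrite /f /patch; case: ifPn => _; rewrite /= lee_fin// normr0.
have f_cvg x : f ^~ x @ \oo --> (U x 0)%:E.
  apply: cvg_near_cst; exists (Num.bound `|x|) => // n /= Nn.
  rewrite /f /patch; case: ifPn => // /negP[]; rewrite inE /I /= in_itv/=.
  have h1 : `|x| < n.+1%:R.
    apply: (lt_le_trans (archi_boundP (normr_ge0 x))).
    by rewrite ler_nat (leq_trans Nn).
  have h2 : (n.+1%:R : R) <= n.+1%:R ^+ 4.
    by apply: ler_eXnr => //; rewrite ler1n.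
  move: h1; rewrite ltr_norml => /andP[? ?]; apply/andP; split; lra.
have ae_cvg : {ae @lebesgue_measure R, forall x, setT x ->
    f ^~ x @ \oo --> (U x 0)%:E} by apply: aeW => x _; exact: f_cvg.
have ae_le : {ae @lebesgue_measure R, forall x n, setT x ->
    (`|f n x| <= `|U x 0|%:E)%E} by apply: aeW => x n _; exact: f_le.
have [_ _] := @dominated_convergence _ _ _ (@lebesgue_measure R) setT measurableT
  f (fun x => (U x 0)%:E) (fun x => `|U x 0|%:E) mf
  ((measurable_EFinP _ _).2 mU)
  ae_cvg (integrable_abse itU) ae_le.
have -> : (\int[@lebesgue_measure R]_(x in setT) (U x 0)%:E)%E =
    (Rintegral (@lebesgue_measure R) setT (U^~ 0))%:E.
  by rewrite /Rintegral fineK//; exact: integrable_fin_num itU.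
pose s n := segment_integral (- n.+1%:R ^+ 4 - 1) (n.+1%:R ^+ 4) (U^~ 0).
have -> : [sequence (\int[@lebesgue_measure R]_(x in setT) f n x)%E]_n =
    (fun n => (s n)%:E).
  apply/funext => n /=; rewrite /f -integral_mkcond.
  rewrite /s /segment_integral /Rintegral fineK//.
  by apply: integrable_fin_num => //; apply: integrableS itU.
move=> /fine_cvg /= sr.
have s0 : s @ \oo --> (0 : R).
  apply/cvgrPdist_le => eps eps0.
  exists (Num.bound ((6 + 4 * M) / eps)) => // n /= Nn.
  rewrite sub0r normrN.
  have n1 : 1 <= n.+1%:R :> R by rewrite ler1n.
  apply: (le_trans (segment_integral_boundary_bound clU clV mass n1)).
  have K0 : 0 <= (6 + 4 * M) / eps.
    by rewrite divr_ge0 ?(ltW eps0)//; lra.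
  rewrite ler_pdivrMr ?ltr0Sn// [X in _ <= X]mulrC -ler_pdivrMr//.
  apply: ltW; apply: (lt_le_trans (archi_boundP K0)).
  by rewrite ler_nat (leq_trans Nn).
exact: (cvg_unique _ sr s0).
Qed.
(** * Moduli and complex differentiability *)

Definition cmod (R : realType) (z : R[i]) : R := complex.Re `|z|.

Lemma cmodE (R : realType) (z : R[i]) : `|z| = (cmod z)%:C.
Proof. by rewrite /cmod normc_def. Qed.

Lemma cmod_ge0 (R : realType) (z : R[i]) : 0 <= cmod z.
Proof. by rewrite /cmod normc_def sqrtr_ge0. Qed.

Lemma cmod_sqr (R : realType) (z : R[i]) :
  cmod z ^+ 2 = complex.Re z ^+ 2 + complex.Im z ^+ 2.
Proof. by rewrite /cmod normc_def sqr_sqrtr// addr_ge0// sqr_ge0. Qed.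

Lemma cmodM (R : realType) (z w : R[i]) : cmod (z * w) = cmod z * cmod w.
Proof.
by apply: (@complexI R); rewrite -cmodE normrM !cmodE -(rmorphM (real_complex R)).
Qed.

Lemma cmodV (R : realType) (z : R[i]) : cmod z^-1 = (cmod z)^-1.
Proof. by apply: (@complexI R); rewrite -cmodE normfV cmodE fmorphV. Qed.

Lemma cmodD (R : realType) (z w : R[i]) : cmod (z + w) <= cmod z + cmod w.
Proof. by rewrite -lecR -cmodE rmorphD/= -!cmodE ler_normD. Qed.

Lemma cmodN (R : realType) (z : R[i]) : cmod (- z) = cmod z.
Proof. by rewrite /cmod normrN. Qed.

Lemma cmodBC (R : realType) (z w : R[i]) : cmod (z - w) = cmod (w - z).
Proof. by rewrite /cmod distrC. Qed.

Lemma cmod0 (R : realType) : cmod (0 : R[i]) = 0.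
Proof. by rewrite /cmod normr0. Qed.

Lemma cmod_eq0 (R : realType) (z : R[i]) : (cmod z == 0) = (z == 0).
Proof. by rewrite -[RHS]normr_eq0 cmodE -(inj_eq (@complexI R)). Qed.

Lemma cmod_gt0 (R : realType) (z : R[i]) : (0 < cmod z) = (z != 0).
Proof. by rewrite lt_neqAle cmod_ge0 andbT eq_sym cmod_eq0. Qed.

Lemma cmodJ (R : realType) (z : R[i]) : cmod (conjc z) = cmod z.
Proof. by rewrite /cmod !normc_def; case: z => a b /=; rewrite sqrrN. Qed.

Lemma normr_Re_le (R : realType) (z : R[i]) : `|complex.Re z| <= cmod z.
Proof.
rewrite -ler_sqr ?nnegrE ?cmod_ge0// cmod_sqr real_normK ?num_real//.
by rewrite lerDl sqr_ge0.
Qed.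

Lemma normr_Im_le (R : realType) (z : R[i]) : `|complex.Im z| <= cmod z.
Proof.
rewrite -ler_sqr ?nnegrE ?cmod_ge0// cmod_sqr real_normK ?num_real//.
by rewrite lerDr sqr_ge0.
Qed.

Lemma cmod_le (R : realType) (z : R[i]) :
  cmod z <= `|complex.Re z| + `|complex.Im z|.
Proof.
rewrite -ler_sqr ?nnegrE ?cmod_ge0 ?addr_ge0// cmod_sqr.
rewrite -(real_normK (num_real (complex.Re z))) -(real_normK (num_real (complex.Im z))).
have := normr_ge0 (complex.Re z); have := normr_ge0 (complex.Im z); nra.
Qed.

Lemma ltc_cmod (R : realType) (z w : R[i]) : (`|z| < `|w|) = (cmod z < cmod w).
Proof. by rewrite !cmodE ltcR. Qed.

Lemma cmod_cis (R : realType) (t : R) : cmod (cis t) = 1.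
Proof.
apply/eqP; rewrite -(@eqrXn2 _ 2)// ?cmod_ge0// cmod_sqr /= cos2Dsin2 expr1n.
exact: eqxx.
Qed.

Lemma conjc_cis (R : realType) (t : R) : conjc (cis t) = cis (- t).
Proof. by rewrite /cis /= cosN sinN. Qed.

Lemma posc_real (R : realType) (z : R[i]) :
  0 < z -> z = (complex.Re z)%:C /\ 0 < complex.Re z.
Proof. by case: z => a b; rewrite ltcE /= => /andP[/eqP -> ->]. Qed.

(** The form of differentiability that passes to the real coordinates. *)
Lemma cdifferentiableP (R : realType) (f : R[i] -> R[i]) (z : R[i]) :
  cdifferentiable f z <-> exists a, forall eps : R, 0 < eps ->
    exists2 delta : R, 0 < delta & forall h, cmod h < delta ->
      cmod (f (z + h) - f z - a * h) <= eps * cmod h.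
Proof.
split.
  move=> /cvg_ex[a fa]; exists a => eps eps0.
  have e0 : 0 < (eps%:C : Cfield R) by rewrite ltcR.
  move/cvgrPdist_le: fa => /(_ _ e0) /= [i i0 iP].
  have [iE ir] := posc_real i0; exists (complex.Re i) => // h hi.
  have [->|h0] := eqVneq h 0; first by rewrite addr0 subrr mulr0 subrr cmod0 mulr0.
  have /= := iP h; rewrite sub0r normrN => /(_ _ h0).
  have hi' : `|h| < i by rewrite iE cmodE ltcR.
  move=> /(_ hi'); rewrite /shift/= -[_%:A]/(h * 1) mulr1 => H.
  have -> : f (z + h) - f z - a * h = - (h * (a - h^-1 * (f (h + z) - f z))).
    by rewrite mulrBr mulVKf// opprB (addrC h) (mulrC a).
  rewrite cmodN cmodM mulrC ler_wpM2r ?cmod_ge0//.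
  by rewrite -lecR -cmodE.
move=> [a fa]; apply/cvg_ex; exists a.
apply/cvgrPdist_le => eps eps0.
have [eE er] := posc_real eps0.
have [d d0 dP] := fa _ er.
exists (d%:C); first by rewrite /= ltcR.
move=> h /=; rewrite sub0r normrN => hd h0.
rewrite /shift/= -[_%:A]/(h * 1) mulr1.
have hd' : cmod h < d by rewrite -ltcR -cmodE.
have := dP h hd'.
have -> : f (z + h) - f z - a * h = - (h * (a - h^-1 * (f (h + z) - f z))).
  by rewrite mulrBr mulVKf// opprB (addrC h) (mulrC a).
rewrite cmodN cmodM mulrC ler_pM2r ?cmod_gt0// => H.
by rewrite eE cmodE lecR.
Qed.
Lemma cdifferentiableM (R : realType) (f g : R[i] -> R[i]) (z : R[i]) :
  cdifferentiable f z -> cdifferentiable g z ->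
  cdifferentiable (fun z => f z * g z) z.
Proof. exact: derivableM. Qed.

Lemma cdifferentiableV (R : realType) (f : R[i] -> R[i]) (z : R[i]) :
  f z != 0 -> cdifferentiable f z -> cdifferentiable (fun z => (f z)^-1) z.
Proof. exact: derivableV. Qed.

Lemma cdifferentiable_cst (R : realType) (k z : R[i]) :
  cdifferentiable (fun=> k) z.
Proof. exact: derivable_cst. Qed.

Lemma cdifferentiable_continuous (R : realType) (f : R[i] -> R[i]) (z : R[i]) :
  cdifferentiable f z -> forall eps : R, 0 < eps ->
  exists2 delta : R, 0 < delta & forall z', cmod (z' - z) < delta ->
    cmod (f z' - f z) <= eps.
Proof.
move=> /cdifferentiableP[a fa] eps eps0; have [d d0 dP] := fa 1 ltr01.
have K0 : 0 < 1 + cmod a by rewrite ltr_pwDl// cmod_ge0.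
exists (Num.min d (eps / (1 + cmod a))); first by rewrite lt_min d0 divr_gt0.
move=> z'; rewrite lt_min => /andP[z'd z'e].
have := dP (z' - z) z'd; rewrite (addrC z) subrK mul1r => H.
have -> : f z' - f z = (f z' - f z - a * (z' - z)) + a * (z' - z) by ring.
apply: (le_trans (cmodD _ _)); rewrite cmodM.
apply: (le_trans (lerD H (lexx _))); rewrite -{1}(mul1r (cmod (z' - z))) -mulrDl.
by rewrite mulrC -ler_pdivlMr// ltW.
Qed.

Lemma entire_sharp (R : realType) (f : R[i] -> R[i]) : entire f -> entire (sharp f).
Proof.
move=> fe z; apply/cdifferentiableP.
have /cdifferentiableP[a fa] := fe (conjc z).
exists (conjc a) => eps eps0; have [d d0 dP] := fa eps eps0.
exists d => // h hd; have := dP (conjc h); rewrite cmodJ => /(_ hd).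
by rewrite /sharp -[X in X <= _]cmodJ !rmorphB rmorphM /= conjcK -rmorphD.
Qed.

(** The Cauchy-Riemann equations: these are the imaginary and the real part of
    F dz. *)
Lemma closed_forms_of_holomorphic (R : realType) (F : R[i] -> R[i]) :
  (forall x y, 0 <= y -> cdifferentiable F (x +i* y)) -> forall A,
  closed_form A (fun x y => complex.Im (F (x +i* y)))
                (fun x y => complex.Re (F (x +i* y))) /\
  closed_form A (fun x y => complex.Re (F (x +i* y)))
                (fun x y => - complex.Im (F (x +i* y))).
Proof.
move=> hF A.
have key x0 y0 : 0 <= y0 -> exists a b, forall eps, 0 < eps ->
  exists2 delta, 0 < delta & forall x y, `|x - x0| < delta -> `|y - y0| < delta ->
   `|complex.Re (F (x +i* y)) - (complex.Re (F (x0 +i* y0)) +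
        a * (x - x0) + - b * (y - y0))| <= eps * (`|x - x0| + `|y - y0|) /\
   `|complex.Im (F (x +i* y)) - (complex.Im (F (x0 +i* y0)) +
        b * (x - x0) + a * (y - y0))| <= eps * (`|x - x0| + `|y - y0|).
  move=> y00; have /cdifferentiableP[[a b] Fab] := hF x0 y0 y00.
  exists a, b => eps eps0; have [d d0 dP] := Fab eps eps0.
  exists (d / 2); first by rewrite divr_gt0.
  move=> x y xd yd; pose h := (x - x0) +i* (y - y0).
  have hle : cmod h <= `|x - x0| + `|y - y0| by exact: cmod_le.
  have hd : cmod h < d by apply: (le_lt_trans hle); lra.
  have := dP h hd.
  have -> : (x0 +i* y0) + h = x +i* y.
    by rewrite /h; apply/eqP; rewrite eq_complex /=; apply/andP; split; apply/eqP; ring.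
  have -> : F (x +i* y) - F (x0 +i* y0) - (a +i* b) * h =
    (complex.Re (F (x +i* y)) - (complex.Re (F (x0 +i* y0)) +
        a * (x - x0) + - b * (y - y0))) +i*
    (complex.Im (F (x +i* y)) - (complex.Im (F (x0 +i* y0)) +
        b * (x - x0) + a * (y - y0))).
    case: (F (x +i* y)) => s t; case: (F (x0 +i* y0)) => s' t'.
    by rewrite /h; apply/eqP; rewrite eq_complex /=; apply/andP; split; apply/eqP; ring.
  move=> H.
  have H' : eps * cmod h <= eps * (`|x - x0| + `|y - y0|).
    by apply: ler_wpM2l hle; exact: ltW.
  have {}H := le_trans H H'.
  by split; [exact: le_trans (normr_Re_le _) H|exact: le_trans (normr_Im_le _) H].
split=> x0 y0 _ y00; have [a [b H]] := key x0 y0 y00.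
  exists b, a, (- b) => eps eps0; have [d d0 dP] := H eps eps0.
  by exists d => // x y _ _ xd yd; have [] := dP x y xd yd.
exists a, (- b), (- a) => eps eps0; have [d d0 dP] := H eps eps0.
exists d => // x y _ _ xd yd; have [h1 h2] := dP x y xd yd; split=> //.
rewrite [X in `|X| <= _](_ : _ = - (complex.Im (F (x +i* y)) -
  (complex.Im (F (x0 +i* y0)) + b * (x - x0) + a * (y - y0)))); last by ring.
by rewrite normrN.
Qed.

Lemma limn_einf_le (R : realType) (u : nat -> \bar R) (M : \bar R) :
  (forall n, (u n <= M)%E) -> (limn_einf u <= M)%E.
Proof.
move=> uM; rewrite limn_einf_lim; apply: lime_le; first exact: is_cvg_einfs.
apply: nearW => n; apply: le_trans (uM n); apply: ereal_inf_lbound.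
by exists n => /=.
Qed.

(** Fatou's lemma along the heights 1 / (n + 1). *)
Lemma mass_at_boundary (R : realType) (M : R) (U V : R -> R -> R) :
  (forall A, closed_form A U V) -> (forall A, closed_form A V (fun x y => - U x y)) ->
  (forall y, 0 < y -> (\int[@lebesgue_measure R]_(x in setT)
     ((1 + x ^+ 2 + y ^+ 2) * (U x y ^+ 2 + V x y ^+ 2))%:E <= M%:E)%E) ->
  (\int[@lebesgue_measure R]_(x in setT)
     ((1 + x ^+ 2 + 0 ^+ 2) * (U x 0 ^+ 2 + V x 0 ^+ 2))%:E <= M%:E)%E.
Proof.
move=> clU clV mass.
pose g y x := (1 + x ^+ 2 + y ^+ 2) * (U x y ^+ 2 + V x y ^+ 2).
pose t n : R := n.+1%:R^-1.
have t0 n : 0 < t n by rewrite invr_gt0.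
have mg y : 0 < y -> measurable_fun setT (g y).
  move=> /ltW y0; apply: measurable_funM.
    by apply: measurable_funD => //; apply: measurable_funD => //.
  apply: measurable_funD; apply: measurable_funX;
    apply: half_line_continuous_measurable => A.
    exact: closed_form_row_continuous (clU A) y0.
  exact: closed_form_row_continuous (clV A) y0.
have t_cvg : t @ \oo --> (0 : R) by exact: cvg_harmonic.
have col (f h : R -> R -> R) x : (forall A, closed_form A f h) ->
    (fun n => h x (t n)) @ \oo --> h x 0.
  move=> cl; apply/cvgrPdist_le => eps eps0.
  have [d d0 dP] := closed_form_column_continuous (cl x) (lexx x) (lexx 0) eps0.
  move/cvgrPdist_lt: t_cvg => /(_ _ d0); apply: filterS => n /= tn.
  rewrite distrC; apply: dP; first exact: ltW.
  by rewrite distrC.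
have g_cvg x : (fun n => (g (t n) x)%:E) @ \oo --> (g 0 x)%:E.
  apply: cvg_EFin; first by apply: nearW.
  have cV := col _ _ x clU.
  have cU : (fun n => U x (t n)) @ \oo --> U x 0.
    have -> : (fun n => U x (t n)) = (fun n => - - U x (t n)).
      by apply/funext => n; rewrite opprK.
    by rewrite -[U x 0]opprK; exact: cvgN (col _ _ x clV).
  apply: cvgM.
    by apply: cvgD; [exact: cvg_cst|rewrite expr2; apply: cvgM].
  by apply: cvgD; rewrite expr2; apply: cvgM.
have -> : (\int[@lebesgue_measure R]_(x in setT) (g 0 x)%:E =
   \int[@lebesgue_measure R]_(x in setT) limn_einf (fun n => (g (t n) x)%:E))%E.
  apply: eq_integral => x _; rewrite is_cvg_limn_einfE; last first.
    by apply/cvg_ex; exists (g 0 x)%:E.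
  by apply/esym/cvg_lim.
apply: le_trans (limn_einf_le _); last by move=> n; exact: (mass (t n) (t0 n)).
apply: fatou => //.
  by move=> n; apply/measurable_EFinP; exact: mg.
move=> n x _; rewrite lee_fin mulr_ge0 ?addr_ge0 ?sqr_ge0//.
Qed.
(** * Hermite-Biehler functions and Hardy bounds *)

Lemma hermite_biehler_neq0 (R : realType) (e : R[i] -> R[i]) (z : R[i]) :
  hermite_biehler e -> 0 < complex.Im z -> e z != 0.
Proof.
move=> [_ he] z0; rewrite -normr_gt0; apply: le_lt_trans (he z z0).
exact: normr_ge0.
Qed.

Lemma holomorphic_row_measurable (R : realType) (F : R[i] -> R[i]) (y : R) :
  (forall x, cdifferentiable F (x +i* y)) ->
  measurable_fun setT (fun x : R => cmod (F (x +i* y)) ^+ 2).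
Proof.
move=> hF; apply: half_line_continuous_measurable => A x0 _ eps eps0.
pose c := cmod (F (x0 +i* y)).
have K0 : 0 < 2 * c + 1 by rewrite ltr_wpDl ?mulr_ge0 ?cmod_ge0.
have e0 : 0 < Num.min 1 (eps / (2 * c + 1)) by rewrite lt_min ltr01 divr_gt0.
have [d d0 dP] := cdifferentiable_continuous (hF x0) e0.
exists d => // x _ xd.
have := dP (x +i* y); rewrite le_min => H.
have {H} /andP[h1 h2] : (cmod (F (x +i* y) - F (x0 +i* y)) <= 1) &&
    (cmod (F (x +i* y) - F (x0 +i* y)) <= eps / (2 * c + 1)).
  apply: H; apply: (le_lt_trans (cmod_le _)) => /=.
  by rewrite subrr normr0 addr0.
rewrite ler_pdivlMr// in h2.
have k1 : cmod (F (x +i* y)) <= cmod (F (x +i* y) - F (x0 +i* y)) + c.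
  by rewrite -{1}(subrK (F (x0 +i* y)) (F (x +i* y))) cmodD.
have k2 : c <= cmod (F (x +i* y) - F (x0 +i* y)) + cmod (F (x +i* y)).
  rewrite cmodBC /c -{1}(subrK (F (x +i* y)) (F (x0 +i* y))); exact: cmodD.
rewrite -/c; have c0 : 0 <= c by exact: cmod_ge0.
have s0 := cmod_ge0 (F (x +i* y)); have d00 := cmod_ge0 (F (x +i* y) - F (x0 +i* y)).
move: (cmod (F (x +i* y))) (cmod (F (x +i* y) - _)) h1 h2 k1 k2 s0 d00 => s dd.
by move=> *; apply/ler_normlP; split; nra.
Qed.

(** |F|^2 (1 + |z|^2) = |F|^2 + |z F|^2, so the two Hardy bounds are one weighted
    bound on horizontal lines; it extends to the real line because e has no zeros
    there. *)
Lemma de_branges_integral_vanishes (R : realType) (e k : R[i] -> R[i]) (al : R[i]) :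
  hermite_biehler e -> (forall x : R, e x%:C != 0) ->
  fs_mem (dB_of e) k -> fs_mem (dB_of e) (fun z => z * k z) -> cmod al = 1 ->
  Rintegral (@lebesgue_measure R) setT
    (fun x => complex.Im (al * (k x%:C / e x%:C))) = 0.
Proof.
move=> he he0 [ek [_ [M1 hM1]] _] [_ [_ [M2 hM2]] _] al1.
pose F z := al * (k z / e z).
have e0 x y : 0 <= y -> e (x +i* y) != 0.
  rewrite le_eqVlt => /predU1P[<-|y0]; first exact: he0.
  exact: hermite_biehler_neq0.
have hF x y : 0 <= y -> cdifferentiable F (x +i* y).
  move=> y0; apply: cdifferentiableM; first exact: cdifferentiable_cst.
  apply: cdifferentiableM; first exact: ek.
  by apply: cdifferentiableV; [exact: e0|exact: he.1].
have cl := closed_forms_of_holomorphic hF.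
have clU A := (cl A).1; have clV A := (cl A).2.
have mass y : 0 < y -> (\int[@lebesgue_measure R]_(x in setT)
    ((1 + x ^+ 2 + y ^+ 2) * (complex.Im (F (x +i* y)) ^+ 2 +
      complex.Re (F (x +i* y)) ^+ 2))%:E <= (M1 + M2)%:E)%E.
  move=> y0.
  have dk z : 0 < complex.Im z -> cdifferentiable (fun z => k z / e z) z.
    move=> z0; apply: cdifferentiableM; first exact: ek.
    by apply: cdifferentiableV; [exact: hermite_biehler_neq0|exact: he.1].
  have did z : cdifferentiable (fun z : R[i] => z) z by exact: derivable_id.
  have dzk z : 0 < complex.Im z -> cdifferentiable (fun z => z * k z / e z) z.
    move=> z0; apply: cdifferentiableM; first exact: cdifferentiableM.
    by apply: cdifferentiableV; [exact: hermite_biehler_neq0|exact: he.1].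
  rewrite EFinD; apply: (le_trans _ (leeD (hM1 y y0) (hM2 y y0))).
  rewrite -ge0_integralD//; first last.
  - apply/measurable_EFinP.
    by apply: (@holomorphic_row_measurable _ (fun z => z * k z / e z)) => x; exact: dzk.
  - by move=> x _; rewrite lee_fin sqr_ge0.
  - apply/measurable_EFinP.
    by apply: (@holomorphic_row_measurable _ (fun z => k z / e z)) => x; exact: dk.
  - by move=> x _; rewrite lee_fin sqr_ge0.
  rewrite le_eqVlt; apply/orP; left; apply/eqP; apply: eq_integral => x _.
  rewrite -EFinD; congr (_%:E).
  rewrite -!/(cmod _) (addrC (complex.Im _ ^+ 2)) -cmod_sqr /F cmodM al1 mul1r.
  rewrite -(mulrA (x +i* y)) (cmodM (x +i* y)) exprMn (cmod_sqr (x +i* y)) /=; ring.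
apply: (@boundary_integral_vanishes _ (M1 + M2)
  (fun x y => complex.Im (F (x +i* y))) (fun x y => complex.Re (F (x +i* y)))) => //.
move=> y; rewrite le_eqVlt => /predU1P[<-|]; last exact: mass.
exact: (mass_at_boundary clU clV mass).
Qed.

Lemma conjM (R : realType) (z w : R[i]) : conjc (z * w) = conjc z * conjc w.
Proof. exact: rmorphM. Qed.

Lemma conjD (R : realType) (z w : R[i]) : conjc (z + w) = conjc z + conjc w.
Proof. exact: rmorphD. Qed.

Lemma conjB (R : realType) (z w : R[i]) : conjc (z - w) = conjc z - conjc w.
Proof. exact: rmorphB. Qed.

Lemma conjV (R : realType) (z : R[i]) : conjc z^-1 = (conjc z)^-1.
Proof. exact: fmorphV. Qed.

Lemma s_fun_sharp (R : realType) (e : R[i] -> R[i]) (gamma : R) :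
  sharp (s_fun e gamma) = s_fun e gamma.
Proof.
apply/funext => z; rewrite /sharp /s_fun !conjM conjB !conjM !conjc_cis opprK.
rewrite conjV conjcK /sharp conjcK.
have -> : conjc (0 +i* 1 : R[i]) = - (0 +i* 1) by rewrite /= -[RHS]/(- 0 +i* - 1) oppr0.
have -> : conjc (2%:R : R[i]) = 2%:R by exact: (rmorph_nat (@conjc R)).
by ring.
Qed.

(** In the upper half plane |e^#| <= |e|. *)
Lemma s_fun_le (R : realType) (e : R[i] -> R[i]) (gamma : R) (z : R[i]) :
  hermite_biehler e -> 0 < complex.Im z -> cmod (s_fun e gamma z) <= cmod (e z).
Proof.
move=> [_ he] z0; have := he z z0; rewrite ltc_cmod => h.
rewrite /s_fun !cmodM cmodV.
have -> : cmod (0 +i* 1 : R[i]) = 1.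
  by apply/eqP; rewrite -(@eqrXn2 _ 2)// ?cmod_ge0// cmod_sqr /= expr0n add0r !expr1n.
have -> : cmod (2%:R : R[i]) = 2.
  by rewrite /cmod ger0_norm ?ler0n// -(rmorph_nat (real_complex R)).
have : cmod (cis gamma * e z - cis (- gamma) * sharp e z) <= cmod (e z) + cmod (e (conjc z)).
  by rewrite (le_trans (cmodD _ _))// cmodN !cmodM !cmod_cis !mul1r /sharp cmodJ.
lra.
Qed.

Lemma s_fun_neq0 (R : realType) (e : R[i] -> R[i]) (gamma : R) (w : R[i]) :
  hermite_biehler e -> nonreal w -> s_fun e gamma w != 0.
Proof.
move=> he; wlog w0 : w / 0 < complex.Im w.
  move=> H hw; case: (ltP 0 (complex.Im w)) => [w0|w0]; first exact: H.
  have wJ : 0 < complex.Im (conjc w).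
    by move: hw w0; rewrite /nonreal; case: w => a b /=; rewrite oppr_gt0 lt_neqAle => -> ->.
  have := H (conjc w) wJ; rewrite -{2}(s_fun_sharp e gamma) /sharp.
  by rewrite /nonreal gt_eqF// => /(_ isT); rewrite -!cmod_eq0 cmodJ.
move=> _; rewrite /s_fun !mulf_neq0//.
  by rewrite eq_complex /= oner_eq0 andbF.
rewrite subr_eq0; apply/eqP => /(congr1 (@cmod R)).
rewrite !cmodM !cmod_cis !mul1r /sharp cmodJ => h.
by have := he.2 w w0; rewrite ltc_cmod h ltxx.
Qed.
(** For G = |g / e|, D = |z - w| and a = |f / e|: away from w, the quotient is
    bounded by f / e and a multiple of 1 / (1 + X^2), where X = Re (z - w). *)
Lemma quotient_bound_far (R : realType) (G D a sg r X : R) :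
  0 <= G -> 0 <= a -> 0 <= sg -> 0 < r -> r <= D -> X ^+ 2 <= D ^+ 2 ->
  D * G <= a + sg ->
  G ^+ 2 <= 2 / r ^+ 2 * a ^+ 2 +
            2 * sg ^+ 2 * (1 + (r ^+ 2)^-1) * (1 + X ^+ 2)^-1.
Proof.
move=> G0 a0 sg0 r0 rD XD DG.
have D0 : 0 < D by exact: lt_le_trans rD.
have r20 : 0 < r ^+ 2 by exact: exprn_gt0.
have D20 : 0 < D ^+ 2 by exact: exprn_gt0.
have X0 : 0 < 1 + X ^+ 2 by rewrite ltr_pwDl// sqr_ge0.
have rD2 : r ^+ 2 <= D ^+ 2 by rewrite ler_sqr ?nnegrE ?(ltW r0) ?(ltW D0).
have h1 : D ^+ 2 * G ^+ 2 <= 2 * a ^+ 2 + 2 * sg ^+ 2.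
  apply: (@le_trans _ _ ((a + sg) ^+ 2)).
    by rewrite -exprMn ler_sqr ?nnegrE ?mulr_ge0 ?addr_ge0 ?(ltW D0).
  by have := sqr_ge0 (a - sg); nra.
have i1 : (D ^+ 2)^-1 <= (r ^+ 2)^-1 by rewrite lef_pV2 ?posrE.
have i2 : (D ^+ 2)^-1 <= (1 + (r ^+ 2)^-1) * (1 + X ^+ 2)^-1.
  rewrite ler_pdivlMr// mulrC ler_pdivrMr// mulrDl mul1r addrC lerD//.
  by rewrite mulrC ler_pdivlMr// mul1r.
apply: (@le_trans _ _ ((2 * a ^+ 2 + 2 * sg ^+ 2) * (D ^+ 2)^-1)).
  by rewrite ler_pdivlMr// mulrC.
rewrite mulrDl; apply: lerD.
  by rewrite mulrAC ler_wpM2r ?sqr_ge0// ler_wpM2l.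
by rewrite -[X in _ <= X]mulrA ler_wpM2l// mulr_ge0// sqr_ge0.
Qed.

Lemma quotient_bound_near (R : realType) (G C r X : R) :
  0 <= G -> G <= C -> X ^+ 2 <= r ^+ 2 ->
  G ^+ 2 <= C ^+ 2 * (1 + r ^+ 2) * (1 + X ^+ 2)^-1.
Proof.
move=> G0 GC Xr.
have X0 : 0 < 1 + X ^+ 2 by rewrite ltr_pwDl// sqr_ge0.
rewrite ler_pdivlMr// ler_pM ?sqr_ge0 ?(ltW X0)//.
  by rewrite ler_sqr ?nnegrE// (le_trans G0).
by rewrite lerD2l.
Qed.

Lemma inv_oneDsqr_shift (R : realType) (x u : R) :
  (1 + (x - u) ^+ 2)^-1 <= 2 * (1 + u ^+ 2) * (1 + x ^+ 2)^-1.
Proof.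
have p (t : R) : 0 < 1 + t ^+ 2 by rewrite ltr_pwDl// sqr_ge0.
rewrite ler_pdivlMr// mulrC ler_pdivrMr//.
have := sqr_ge0 (x - u - u); have := sqr_ge0 ((x - u) * u); nra.
Qed.

(** Near w the quotient g / e is continuous, hence bounded; this only matters when
    w is in the upper half plane.  Away from w it is at most
    (|f / e| + |sg|) / |z - w|, since |s / e| <= 1. *)
Lemma hardy2_difference_quotient (R : realType) (e f g : R[i] -> R[i])
    (gamma : R) (w sg : R[i]) :
  hermite_biehler e -> nonreal w -> entire g -> hardy2 (fun z => f z / e z) ->
  (forall z, (z - w) * g z = f z - sg * s_fun e gamma z) ->
  hardy2 (fun z => g z / e z).
Proof.
move=> he hw eg [df [M hM]] gE.
have dg z : 0 < complex.Im z -> cdifferentiable (fun z => g z / e z) z.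
  move=> z0; apply: cdifferentiableM; first exact: eg.
  by apply: cdifferentiableV; [exact: hermite_biehler_neq0|exact: he.1].
split=> //.
have [r r0 [C C0 near_w]] : exists2 r : R, 0 < r & exists2 C : R, 0 <= C &
    forall z, 0 < complex.Im z -> cmod (z - w) < r -> cmod (g z / e z) <= C.
  case: (ltP 0 (complex.Im w)) => [w0|w0].
    have [d d0 dP] := cdifferentiable_continuous (dg w w0) ltr01.
    exists d => //; exists (1 + cmod (g w / e w)); first by rewrite addr_ge0 ?cmod_ge0.
    move=> z _ zw; rewrite -(subrK (g w / e w) (g z / e z)).
    by apply: (le_trans (cmodD _ _)); rewrite lerD2r; exact: dP.
  have w0' : 0 < - complex.Im w by rewrite oppr_gt0 lt_neqAle w0 andbT.
  exists (- complex.Im w) => //; exists 0 => // z z0 zw; exfalso.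
  have := le_lt_trans (normr_Im_le _) zw.
  have -> : complex.Im (z - w) = complex.Im z - complex.Im w by case: (z) (w) => ? ? [].
  by rewrite ger0_norm; lra.
pose u := complex.Re w.
pose K1 := C ^+ 2 * (1 + r ^+ 2).
pose K2 := 2 * cmod sg ^+ 2 * (1 + (r ^+ 2)^-1).
have K10 : 0 <= K1 by rewrite mulr_ge0 ?addr_ge0 ?sqr_ge0 ?ler01.
have K20 : 0 <= K2 by rewrite !mulr_ge0 ?addr_ge0 ?invr_ge0 ?sqr_ge0 ?cmod_ge0 ?ler01 ?ler0n.
pose al := 2 / r ^+ 2; pose be := (K1 + K2) * (2 * (1 + u ^+ 2)).
have al0 : 0 <= al by rewrite divr_ge0 ?sqr_ge0 ?ler0n.
have be0 : 0 <= be.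
  by apply: mulr_ge0; [exact: addr_ge0|rewrite mulr_ge0 ?ler0n// addr_ge0 ?sqr_ge0 ?ler01].
have bound x y : 0 < y -> cmod (g (x +i* y) / e (x +i* y)) ^+ 2 <=
    al * cmod (f (x +i* y) / e (x +i* y)) ^+ 2 + be * (1 + x ^+ 2)^-1.
  move=> y0; set z := x +i* y.
  have z0 : 0 < complex.Im z by [].
  have ez : e z != 0 by exact: hermite_biehler_neq0.
  have Xz : (x - u) ^+ 2 <= cmod (z - w) ^+ 2.
    rewrite cmod_sqr; have -> : complex.Re (z - w) = x - u.
      by rewrite /z /u; case: (w).
    by rewrite lerDl sqr_ge0.
  have pX : 0 < (1 + (x - u) ^+ 2)^-1 by rewrite invr_gt0 ltr_pwDl// sqr_ge0.
  have sh := inv_oneDsqr_shift x u.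
  apply: (@le_trans _ _ (al * cmod (f z / e z) ^+ 2 +
      (K1 + K2) * (1 + (x - u) ^+ 2)^-1)); last first.
    by rewrite lerD2l /be -[X in _ <= X]mulrA ler_wpM2l// addr_ge0.
  case: (ltP (cmod (z - w)) r) => zr.
    apply: (le_trans (quotient_bound_near (r := r) (X := x - u) (cmod_ge0 _)
      (near_w z z0 zr) _)).
      apply: (le_trans Xz); rewrite !expr2.
      by apply: ler_pM; rewrite ?cmod_ge0// ltW.
    rewrite -/K1 [X in _ <= _ + X](mulrDl K1 K2) -[X in X <= _]add0r; apply: lerD.
      by rewrite mulr_ge0 ?sqr_ge0.
    by rewrite lerDl mulr_ge0 ?(ltW pX).
  apply: (le_trans (quotient_bound_far (D := cmod (z - w)) (r := r)
    (a := cmod (f z / e z)) (sg := cmod sg) (X := x - u) (cmod_ge0 _)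
    (cmod_ge0 _) (cmod_ge0 _) r0 zr Xz _)); last first.
    by rewrite lerD2l ler_wpM2r ?(ltW pX)// lerDr.
  rewrite -cmodM mulrA gE mulrBl; apply: (le_trans (cmodD _ _)).
  rewrite cmodN lerD2l -mulrA cmodM ler_piMr ?cmod_ge0//.
  by rewrite cmodM cmodV ler_pdivrMr ?cmod_gt0// mul1r s_fun_le.
have itP := integrable_inv_oneDsqr R.
pose P := fine (\int[@lebesgue_measure R]_(x in setT) ((1 + x ^+ 2)^-1)%:E)%E.
have PE : (\int[@lebesgue_measure R]_(x in setT) ((1 + x ^+ 2)^-1)%:E = P%:E)%E.
  by rewrite /P fineK//; exact: integrable_fin_num itP.
have mP : measurable_fun setT (fun x : R => (1 + x ^+ 2)^-1).
  by apply/measurable_EFinP; exact: measurable_int itP.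
have p0 (x : R) : 0 <= (1 + x ^+ 2)^-1 by rewrite invr_ge0 addr_ge0 ?sqr_ge0 ?ler01.
exists (al * M + be * P) => y y0.
have mf : measurable_fun setT (fun x : R => cmod (f (x +i* y) / e (x +i* y)) ^+ 2).
  by apply: (@holomorphic_row_measurable _ (fun z => f z / e z)) => x; exact: df.
have mg : measurable_fun setT (fun x : R => cmod (g (x +i* y) / e (x +i* y)) ^+ 2).
  by apply: (@holomorphic_row_measurable _ (fun z => g z / e z)) => x; exact: dg.
apply: (@le_trans _ _ (\int[@lebesgue_measure R]_(x in setT)
  (al%:E * (cmod (f (x +i* y) / e (x +i* y)) ^+ 2)%:E +
   be%:E * ((1 + x ^+ 2)^-1)%:E))%E).
  apply: ge0_le_integral => //.
  - by move=> x _; rewrite lee_fin sqr_ge0.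
  - exact/measurable_EFinP.
  - by apply: emeasurable_funD; apply: measurable_funeM; exact/measurable_EFinP.
  - by move=> x _; rewrite -!EFinM -EFinD lee_fin; exact: bound.
rewrite ge0_integralD//; first last.
- by apply: measurable_funeM; exact/measurable_EFinP.
- by move=> x _; rewrite -EFinM lee_fin mulr_ge0.
- by apply: measurable_funeM; exact/measurable_EFinP.
- by move=> x _; rewrite -EFinM lee_fin mulr_ge0// sqr_ge0.
rewrite !ge0_integralZl//; first last.
- by move=> x _; rewrite lee_fin sqr_ge0.
- exact/measurable_EFinP.
- by move=> x _; rewrite lee_fin.
- exact/measurable_EFinP.
rewrite PE EFinD !EFinM leeD2r// lee_wpmul2l ?lee_fin//.
exact: hM.
Qed.
(** * Pairs of the graph of S_gamma *)

Definition lincomb (R : realType) (a : R[i]) (f : R[i] -> R[i]) (b : R[i])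
  (g : R[i] -> R[i]) : R[i] -> R[i] := fun z => a * f z + b * g z.

Lemma lincomb_mem (R : realType) (H : fspace R) (a b : R[i]) (f g : R[i] -> R[i]) :
  fs_subspace H -> fs_mem H f -> fs_mem H g -> fs_mem H (lincomb a f b g).
Proof.
by move=> [_ hD hZ] Hf Hg; apply: (hD (fun z => a * f z)); apply: hZ.
Qed.

Lemma lincomb_sub (R : realType) (f g : R[i] -> R[i]) :
  (fun z => f z - g z) = lincomb 1 f (-1) g.
Proof. by apply/funext => z; rewrite /lincomb mul1r mulN1r. Qed.

Lemma ip_lincomb_r (R : realType) (H : fspace R) (a b : R[i]) (f g h : R[i] -> R[i]) :
  fs_subspace H -> fs_inner_product H -> fs_mem H f -> fs_mem H g -> fs_mem H h ->
  fs_ip H h (lincomb a f b g) = a * fs_ip H h f + b * fs_ip H h g.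
Proof.
move=> [_ _ sZ] [_ hD hZ _ _] Hf Hg Hh.
rewrite (hD h (fun z => a * f z) (fun z => b * g z))//; try exact: sZ.
by rewrite !hZ.
Qed.

Lemma ip_lincomb_l (R : realType) (H : fspace R) (a b : R[i]) (f g h : R[i] -> R[i]) :
  fs_subspace H -> fs_inner_product H -> fs_mem H f -> fs_mem H g -> fs_mem H h ->
  fs_ip H (lincomb a f b g) h = conjc a * fs_ip H f h + conjc b * fs_ip H g h.
Proof.
move=> sH iH Hf Hg Hh; have [hJ _ _ _ _] := iH.
rewrite hJ//; last exact: lincomb_mem.
by rewrite ip_lincomb_r// conjD !conjM (hJ f h)// (hJ g h).
Qed.

Lemma ip_norm_sqr (R : realType) (H : fspace R) (f : R[i] -> R[i]) :
  fs_inner_product H -> fs_mem H f -> fs_ip H f f = (fs_norm H f ^+ 2)%:C.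
Proof.
move=> [_ _ _ h0 _] Hf; have := h0 f Hf; rewrite /fs_norm.
case: (fs_ip H f f) => a b; rewrite lecE /= => /andP[/eqP -> a0].
by rewrite sqr_sqrtr.
Qed.

(** The graph of S_gamma without reference to a base point. *)
Definition extension_pair (R : realType) (B : fspace R) (e : R[i] -> R[i])
    (gamma : R) (g h : R[i] -> R[i]) : Prop :=
  [/\ fs_mem B g, fs_mem B h &
      exists c, forall z, h z = z * g z + c * s_fun e gamma z].

Lemma extension_pair_lincomb (R : realType) (B : fspace R) (e : R[i] -> R[i])
    (gamma : R) (a b : R[i]) (g1 h1 g2 h2 : R[i] -> R[i]) :
  fs_subspace B -> extension_pair B e gamma g1 h1 -> extension_pair B e gamma g2 h2 ->
  extension_pair B e gamma (lincomb a g1 b g2) (lincomb a h1 b h2).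
Proof.
move=> sB [Bg1 Bh1 [c1 E1]] [Bg2 Bh2 [c2 E2]].
split; [exact: lincomb_mem|exact: lincomb_mem|exists (a * c1 + b * c2) => z].
by rewrite /lincomb E1 E2; ring.
Qed.

Lemma extension_pair_sharp (R : realType) (B : fspace R) (e : R[i] -> R[i])
    (gamma : R) (g h : R[i] -> R[i]) :
  (forall f, fs_mem B f -> fs_mem B (sharp f)) ->
  extension_pair B e gamma g h -> extension_pair B e gamma (sharp g) (sharp h).
Proof.
move=> Bsharp [Bg Bh [c E]]; split; [exact: Bsharp|exact: Bsharp|].
exists (conjc c) => z; rewrite -[in RHS](s_fun_sharp e gamma) /sharp E.
by rewrite conjD (conjM (conjc z)) (conjM c) conjcK.
Qed.

(** From f to the pair: h = f + w g and c = f(w) / s(w).  Back: f = h - w g, whose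
    value at w is c s(w). *)
Lemma graph_S_gammaE (R : realType) (B : fspace R) (e : R[i] -> R[i])
    (gamma : R) (w : R[i]) (g h : R[i] -> R[i]) :
  (forall f, fs_mem B f -> entire f) -> fs_subspace B ->
  (forall f, fs_mem B f -> fs_mem B (sharp f)) ->
  hermite_biehler e -> fs_mem B = fs_mem (dB_of e) -> nonreal w ->
  graph_S_gamma B e gamma w g h <-> extension_pair B e gamma g h.
Proof.
move=> Be sB Bsharp he BE hw; have sw := s_fun_neq0 gamma he hw.
split=> [[f [Bf eg gE ->]]|[Bg Bh [c hE]]].
  pose sg := f w / s_fun e gamma w.
  have gE' z : (z - w) * g z = f z - sg * s_fun e gamma z.
    have [->|zw] := eqVneq z w; first by rewrite subrr mul0r /sg divfK// subrr.
    by rewrite gE// mulrC divfK ?subr_eq0// /sg; congr (_ - _); field.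
  have gEs z : (z - conjc w) * sharp g z =
      sharp f z - conjc sg * s_fun e gamma z.
    rewrite -(s_fun_sharp e gamma) /sharp -conjM -conjB -gE' conjM conjB conjcK.
    by [].
  have Bg : fs_mem B g.
    rewrite BE; split=> //.
      have [_ h1 _] : fs_mem (dB_of e) f by rewrite -BE.
      exact: hardy2_difference_quotient he hw eg h1 gE'.
    have [_ h1 _] : fs_mem (dB_of e) (sharp f) by rewrite -BE; exact: Bsharp.
    apply: hardy2_difference_quotient he _ (entire_sharp eg) h1 gEs.
    by move: hw; rewrite /nonreal; case: (w) => a b /=; rewrite oppr_eq0.
  have hE z : z * g z + f w * (s_fun e gamma z / s_fun e gamma w) =
      lincomb 1 f w g z.
    rewrite /lincomb mul1r; have := gE' z; rewrite mulrBl => /eqP.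
    by rewrite subr_eq => /eqP ->; rewrite /sg; field.
  split=> //; last by exists sg => z; rewrite /sg; field.
  by rewrite (_ : (fun z => _) = lincomb 1 f w g); [exact: lincomb_mem|exact/funext].
have fw : lincomb 1 h (- w) g w = c * s_fun e gamma w.
  by rewrite /lincomb hE; ring.
exists (lincomb 1 h (- w) g); split.
- exact: lincomb_mem.
- exact: Be.
- move=> z zw; rewrite fw /lincomb hE.
  by field; rewrite subr_eq0 zw.
by apply: funext => z; rewrite fw hE; congr (_ + _); field.
Qed.

(** On the real line s = - Im (e^(i gamma) e), and dividing by |e|^2 turns it into
    Im (e^(-i gamma) / e); the real factor Im (c conj g) moves inside. *)
Lemma form_integrand_real (R : realType) (x gam : R) (E g c : R[i]) :
  E != 0 ->
  complex.Im (conjc g * (x%:C * g + c * ((0 +i* 1) / 2%:R *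
     (cis gam * E - cis (- gam) * conjc E))) / `|E| ^+ 2) =
  complex.Im (cis (- gam) * (((2%:R * (0 +i* 1))^-1 * c * conjc g +
     - ((2%:R * (0 +i* 1))^-1 * conjc c) * g) / E)).
Proof.
move=> E0.
have -> : `|E| ^+ 2 = (complex.Re E ^+ 2 + complex.Im E ^+ 2)%:C.
  by rewrite add_Re2_Im2.
have -> : (2%:R * (0 +i* 1) : R[i])^-1 = 0 +i* (- 2^-1).
  have nz : 2%:R * (0 +i* 1) != 0 :> R[i].
    rewrite mulf_eq0 negb_or pnatr_eq0/=.
    by rewrite eq_complex /= oner_eq0 andbF.
  apply: (mulfI nz); rewrite divff//.
  by apply/eqP; rewrite eq_complex /=; apply/andP; split; apply/eqP; field.
have -> : (0 +i* 1 : R[i]) / 2%:R = 0 +i* 2^-1.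
  apply: (@mulIf _ 2%:R); first by rewrite pnatr_eq0.
  rewrite divfK ?pnatr_eq0//.
  by apply/eqP; rewrite eq_complex /=; apply/andP; split; apply/eqP; field.
rewrite -fmorphV /cis cosN sinN.
have : complex.Re E ^+ 2 + complex.Im E ^+ 2 != 0.
  by rewrite -cmod_sqr sqrf_eq0 cmod_eq0.
move: (cos gam) (sin gam) => co si; clear E0.
case: E g c => e1 e2 [g1 g2] [c1 c2] /= ee.
by field.
Qed.

(** For k = (c g^# - conj c g) / 2i, the multiples of s in c h^# and conj c h
    cancel, so that z k = (c h^# - conj c h) / 2i. *)
Lemma extension_pair_form_real (R : realType) (B : fspace R) (e : R[i] -> R[i])
    (gamma : R) (g h : R[i] -> R[i]) :
  fs_subspace B -> (forall f, fs_mem B f -> fs_mem B (sharp f)) ->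
  hermite_biehler e -> (forall x : R, e x%:C != 0) ->
  fs_isometric_eq B (dB_of e) -> extension_pair B e gamma g h ->
  complex.Im (fs_ip B g h) = 0.
Proof.
move=> sB Bsharp he he0 [BE ipE] [Bg Bh [c hE]].
rewrite ipE// /fs_ip /= /cintegral /=.
pose I2 : R[i] := (2%:R * (0 +i* 1))^-1.
pose k := lincomb (I2 * c) (sharp g) (- (I2 * conjc c)) g.
have Bk : fs_mem B k by apply: lincomb_mem => //; exact: Bsharp.
have zkE : (fun z => z * k z) = lincomb (I2 * c) (sharp h) (- (I2 * conjc c)) h.
  apply/funext => z; rewrite /k /lincomb hE /sharp hE conjD (conjM (conjc z)) (conjM c) conjcK.
  have -> : conjc (s_fun e gamma (conjc z)) = s_fun e gamma z.
    exact: (congr1 (@^~ z) (s_fun_sharp e gamma)).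
  ring.
have Bzk : fs_mem B (fun z => z * k z).
  by rewrite zkE; apply: lincomb_mem => //; exact: Bsharp.
rewrite BE in Bk Bzk.
rewrite -[RHS](de_branges_integral_vanishes he he0 Bk Bzk (cmod_cis (- gamma))).
apply: eq_Rintegral => x _.
have xJ : conjc (x%:C : R[i]) = x%:C by rewrite /= oppr0.
rewrite hE /k /lincomb /s_fun /sharp xJ; exact: form_integrand_real.
Qed.
(** Polarization, with the coefficients 1 and i. *)
Lemma extension_symmetric (R : realType) (B : fspace R) (e : R[i] -> R[i])
    (gamma : R) (g1 h1 g2 h2 : R[i] -> R[i]) :
  fs_subspace B -> fs_inner_product B ->
  (forall g h, extension_pair B e gamma g h -> complex.Im (fs_ip B g h) = 0) ->
  extension_pair B e gamma g1 h1 -> extension_pair B e gamma g2 h2 ->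
  fs_ip B g1 h2 = fs_ip B h1 g2.
Proof.
move=> sB iB real p1 p2.
have [Bg1 Bh1 _] := p1; have [Bg2 Bh2 _] := p2.
have key a : complex.Im (a * fs_ip B g1 h2 + conjc a * conjc (fs_ip B h1 g2)) = 0.
  have := real _ _ (extension_pair_lincomb 1 a sB p1 p2).
  rewrite ip_lincomb_l//; last exact: lincomb_mem.
  rewrite !ip_lincomb_r//.
  have [hJ _ _ _ _] := iB; rewrite -(hJ g2 h1)//.
  move: (real _ _ p1) (real _ _ p2).
  case: (fs_ip B g1 h1) (fs_ip B g2 h2) (fs_ip B g1 h2) (fs_ip B g2 h1) a
    => a1 b1 [a2 b2] [a3 b3] [a4 b4] [a5 b5] /= -> ->.
  by move=> <-; ring.
have := key 1; have := key (0 +i* 1).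
case: (fs_ip B g1 h2) (fs_ip B h1 g2) => a b [a' b'] /= k1 k2.
by apply/eqP; rewrite eq_complex /=; apply/andP; split; apply/eqP; lra.
Qed.

(** If (0, d) is a pair, then <k, d> = <z k, 0> = 0 for k in dom S.  An orthogonal
    k gives |d| <= |d - k|, and density makes the right side arbitrarily small. *)
Lemma extension_pair_unique (R : realType) (B : fspace R) (e : R[i] -> R[i])
    (gamma : R) (g h1 h2 : R[i] -> R[i]) :
  fs_subspace B -> fs_inner_product B ->
  (forall g h, extension_pair B e gamma g h -> complex.Im (fs_ip B g h) = 0) ->
  fs_dense B (dom_S B) ->
  extension_pair B e gamma g h1 -> extension_pair B e gamma g h2 -> h1 = h2.
Proof.
move=> sB iB real dense p1 p2.
have := extension_pair_lincomb 1 (-1) sB p1 p2.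
set d := lincomb 1 h1 (-1) h2 => pd.
have [B0 Bd _] := pd; have [Bg _ _] := p1.
have orth k : dom_S B k -> fs_ip B k d = 0.
  move=> [Bk Bzk].
  have pk : extension_pair B e gamma k (fun z => z * k z).
    by split=> //; exists 0 => z; rewrite mul0r addr0.
  rewrite (extension_symmetric sB iB real pk pd) ip_lincomb_r//; ring.
have norm_d eps : 0 < eps -> fs_norm B d < eps.
  move=> eps0; have [k dk] := dense d Bd eps eps0; apply: le_lt_trans.
  have [Bk _] := dk; have dk0 := orth k dk.
  have kd0 : fs_ip B d k = 0 by have [hJ _ _ _ _] := iB; rewrite hJ// dk0 rmorph0.
  rewrite -ler_sqr ?nnegrE ?sqrtr_ge0// -lecR -!ip_norm_sqr//; last first.
    by rewrite lincomb_sub; exact: lincomb_mem.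
  rewrite lincomb_sub ip_lincomb_l//; last exact: lincomb_mem.
  rewrite (ip_lincomb_r 1 (-1) sB iB Bd Bk Bd) (ip_lincomb_r 1 (-1) sB iB Bd Bk Bk).
  rewrite dk0 kd0.
  have -> : conjc (-1 : R[i]) = -1 by rewrite rmorphN1.
  have -> : conjc (1 : R[i]) = 1 by rewrite rmorph1.
  have [_ _ _ h0 _] := iB.
  rewrite [X in _ <= X](_ : _ = fs_ip B d d + fs_ip B k k); last by ring.
  by rewrite lerDl; exact: h0.
have d0 : fs_norm B d = 0.
  apply/eqP; rewrite eq_le sqrtr_ge0 andbT leNgt; apply/negP => dpos.
  by have := norm_d _ dpos; rewrite ltxx.
have [_ _ _ _ hdef] := iB.
have dz : d = fun=> 0 by apply: hdef => //; rewrite ip_norm_sqr// d0 expr0n.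
apply: funext => z; apply/eqP; rewrite -subr_eq0; apply/eqP.
by have := congr1 (@^~ z) dz; rewrite /d /lincomb /= mul1r mulN1r.
Qed.

(** The definition of h' is (S - v) g' = (S - conj v) g.  Pairing this with g' and
    with g, symmetry gives <g', S g'> = <g, S g>; expanding the norms of the two
    sides then leaves |S g'| = |S g|. *)
Lemma cayley_norm (R : realType) (B : fspace R) (e : R[i] -> R[i])
    (gamma : R) (v : R[i]) (g h g' : R[i] -> R[i]) :
  fs_subspace B -> fs_inner_product B ->
  (forall g h, extension_pair B e gamma g h -> complex.Im (fs_ip B g h) = 0) ->
  extension_pair B e gamma g h ->
  let h' := lincomb 1 (lincomb 1 h (- conjc v) g) v g' in
  extension_pair B e gamma g' h' ->
  fs_norm B g' = fs_norm B g -> fs_norm B h' = fs_norm B h.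
Proof.
move=> sB iB real p h' p' ng.
have [Bg Bh _] := p; have [Bg' Bh' _] := p'.
have Bm : fs_mem B (lincomb 1 h (- conjc v) g) by exact: lincomb_mem.
have nn : fs_ip B g' g' = fs_ip B g g by rewrite !ip_norm_sqr// ng.
have sym : fs_ip B g' h' = fs_ip B h' g' := extension_symmetric sB iB real p' p'.
have sym0 : fs_ip B g h = fs_ip B h g := extension_symmetric sB iB real p p.
have symx : fs_ip B g' h = fs_ip B h' g := extension_symmetric sB iB real p' p.
have c1 : conjc (1 : R[i]) = 1 by rewrite rmorph1.
have cv : conjc (- conjc v) = - v by rewrite rmorphN /= conjcK.
have e1 : fs_ip B g' h' =
    fs_ip B g' h - conjc v * fs_ip B g' g + v * fs_ip B g' g'.
  by rewrite /h' !ip_lincomb_r//; ring.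
have e2 : fs_ip B h' g =
    fs_ip B h g - v * fs_ip B g g + conjc v * fs_ip B g' g.
  by rewrite /h' !ip_lincomb_l// c1 cv; ring.
have forms : fs_ip B g' h' = fs_ip B g h.
  by rewrite e1 symx e2 sym0 nn; ring.
have diff : lincomb 1 h' (- v) g' = lincomb 1 h (- conjc v) g.
  by apply: funext => z; rewrite /h' /lincomb; ring.
have e3 : fs_ip B (lincomb 1 h' (- v) g') (lincomb 1 h' (- v) g') =
    fs_ip B h' h' - v * fs_ip B h' g' - conjc v * fs_ip B g' h' +
    conjc v * v * fs_ip B g' g'.
  rewrite ip_lincomb_l//; last exact: lincomb_mem.
  by rewrite !ip_lincomb_r// c1 (rmorphN (@conjc R)); ring.
have e4 : fs_ip B (lincomb 1 h (- conjc v) g) (lincomb 1 h (- conjc v) g) =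
    fs_ip B h h - conjc v * fs_ip B h g - v * fs_ip B g h +
    conjc v * v * fs_ip B g g.
  by rewrite ip_lincomb_l// !ip_lincomb_r// c1 cv; ring.
have : fs_ip B h' h' = fs_ip B h h.
  move: e3; rewrite diff e4 -sym -sym0 forms nn => e5.
  have -> : fs_ip B h' h' = (fs_ip B h' h' - v * fs_ip B g h -
    conjc v * fs_ip B g h + conjc v * v * fs_ip B g g) +
    (v * fs_ip B g h + conjc v * fs_ip B g h - conjc v * v * fs_ip B g g) by ring.
  by rewrite -e5; ring.
by rewrite /fs_norm => ->.
Qed.
Lemma evaluation_limit (R : realType) (B : fspace R) (u : nat -> R[i] -> R[i])
    (g : R[i] -> R[i]) (z : R[i]) :
  fs_evaluation_continuous B -> (forall n, fs_mem B (u n)) -> fs_mem B g ->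
  (forall eps : R, 0 < eps -> exists N, forall n, (N <= n)%N ->
     fs_norm B (fun z => u n z - g z) < eps) ->
  forall eps : R, 0 < eps -> exists N, forall n, (N <= n)%N ->
    cmod (g z - u n z) < eps.
Proof.
move=> ev Bu Bg ug eps eps0; have [d d0 dP] := ev z g Bg eps eps0.
have [N NP] := ug d d0; exists N => n Nn; rewrite cmodBC.
exact: dP (Bu n) (NP n Nn).
Qed.

(** The functional D = h(z) - z g(z) - (s(z) / s(w)) (h(w) - w g(w)) vanishes on
    pairs and involves the values at z and w only. *)
Lemma extension_pair_closed (R : realType) (B : fspace R) (e : R[i] -> R[i])
    (gamma : R) (w : R[i]) (u t : nat -> R[i] -> R[i]) (g h : R[i] -> R[i]) :
  fs_evaluation_continuous B -> s_fun e gamma w != 0 ->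
  (forall n, extension_pair B e gamma (u n) (t n)) ->
  fs_mem B g -> fs_mem B h ->
  (forall eps : R, 0 < eps -> exists N, forall n, (N <= n)%N ->
     fs_norm B (fun z => u n z - g z) < eps) ->
  (forall eps : R, 0 < eps -> exists N, forall n, (N <= n)%N ->
     fs_norm B (fun z => t n z - h z) < eps) ->
  extension_pair B e gamma g h.
Proof.
move=> ev sw ut Bg Bh ug th.
have Bu n : fs_mem B (u n) by have [] := ut n.
have Bt n : fs_mem B (t n) by have [] := ut n.
split=> //; exists ((h w - w * g w) / s_fun e gamma w) => z.
set s := s_fun e gamma in sw *; pose kap := s z / s w.
pose D := h z - z * g z - kap * (h w - w * g w).
suff D0 : D = 0.
  have : D + z * g z + kap * (h w - w * g w) = h z by rewrite /D; ring.
  by rewrite D0 add0r => <-; rewrite /kap; congr (_ + _); field.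
apply/eqP; rewrite -cmod_eq0 eq_le cmod_ge0 andbT leNgt; apply/negP => Dpos.
pose K := 1 + cmod z + cmod kap * (1 + cmod w).
have K0 : 0 < K.
  by rewrite /K ltr_wpDr ?mulr_ge0 ?cmod_ge0 ?addr_ge0 ?cmod_ge0// ltr_pwDl ?cmod_ge0.
have eps0 : 0 < cmod D / K by rewrite divr_gt0.
have [N1 P1] := evaluation_limit z ev Bu Bg ug eps0.
have [N2 P2] := evaluation_limit z ev Bt Bh th eps0.
have [N3 P3] := evaluation_limit w ev Bu Bg ug eps0.
have [N4 P4] := evaluation_limit w ev Bt Bh th eps0.
pose n := maxn (maxn N1 N2) (maxn N3 N4).
have {P1} a1 := P1 n ltac:(by rewrite /n !leq_max leqnn ?orbT).
have {P2} a2 := P2 n ltac:(by rewrite /n !leq_max leqnn ?orbT).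
have {P3} a3 := P3 n ltac:(by rewrite /n !leq_max leqnn ?orbT).
have {P4} a4 := P4 n ltac:(by rewrite /n !leq_max leqnn ?orbT).
have [_ _ [c tE]] := ut n.
have DE : D = (h z - t n z) + - (z * (g z - u n z)) +
    - (kap * ((h w - t n w) + - (w * (g w - u n w)))).
  by rewrite /D !tE /kap -/s; field.
have : cmod D <= cmod (h z - t n z) + cmod z * cmod (g z - u n z) +
    cmod kap * (cmod (h w - t n w) + cmod w * cmod (g w - u n w)).
  rewrite {1}DE; apply: (le_trans (cmodD _ _)); apply: lerD.
    by apply: (le_trans (cmodD _ _)); rewrite cmodN cmodM.
  rewrite cmodN cmodM; apply: ler_wpM2l; first exact: cmod_ge0.
  by apply: (le_trans (cmodD _ _)); rewrite cmodN cmodM.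
have Keps : cmod D / K * K = cmod D by rewrite divfK// gt_eqF.
have b1 : cmod z * cmod (g z - u n z) <= cmod z * (cmod D / K).
  by apply: ler_wpM2l; [exact: cmod_ge0|exact: ltW].
have b2 : cmod w * cmod (g w - u n w) <= cmod w * (cmod D / K).
  by apply: ler_wpM2l; [exact: cmod_ge0|exact: ltW].
have b3 : cmod kap * (cmod (h w - t n w) + cmod w * cmod (g w - u n w)) <=
    cmod kap * (cmod D / K + cmod w * (cmod D / K)).
  by apply: ler_wpM2l; [exact: cmod_ge0|apply: lerD => //; exact: ltW].
apply/negP; rewrite -ltNge -[X in _ < X]Keps {2}/K.
rewrite (_ : cmod D / K * _ = cmod D / K + cmod z * (cmod D / K) +
  cmod kap * (cmod D / K + cmod w * (cmod D / K))); last by ring.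
by apply: ltr_leD => //; exact: ltr_leD.
Qed.

Lemma sqrt_add_sqr_lt (R : realType) (a b eps : R) :
  0 <= a -> 0 <= b -> a < eps / 2 -> b < eps / 2 ->
  Num.sqrt (a ^+ 2 + b ^+ 2) < eps.
Proof.
move=> a0 b0 ae be; have e0 : 0 < eps by lra.
rewrite -(ger0_norm (ltW e0)) -sqrtr_sqr ltr_sqrt ?exprn_gt0//; nra.
Qed.

Lemma le_sqrt_add_sqr (R : realType) (a b : R) :
  0 <= a -> a <= Num.sqrt (a ^+ 2 + b ^+ 2).
Proof.
move=> a0; rewrite -{1}(ger0_norm a0) -sqrtr_sqr ler_wsqrtr//.
by rewrite lerDl sqr_ge0.
Qed.

Theorem theorem3p1 (R : realType) (B : fspace R) (e : R[i] -> R[i])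
    (hB : dB_space B) (hB0 : fs_nonzero B)
    (he : hermite_biehler e) (he0 : forall x : R, e x%:C != 0)
    (hBe : fs_isometric_eq B (dB_of e))
    (hS : fs_dense B (dom_S B))
    (gamma : R) (hgamma : 0 <= gamma < pi)
    (w : R[i]) (hw : nonreal w) :
  dB_space (graph_space B e gamma w).
Proof.
have [[Be sB iB cB] evB sharpB divB] := hB.
have Bsharp f : fs_mem B f -> fs_mem B (sharp f) by move=> /sharpB[].
have graphE g h := graph_S_gammaE gamma g h Be sB Bsharp he hBe.1 hw.
have real g h := extension_pair_form_real sB Bsharp he he0 hBe (g := g) (h := h)
  (gamma := gamma).
have uniq g h1 h2 := extension_pair_unique sB iB real hS (g := g) (h1 := h1) (h2 := h2).
pose T := S_gamma B e gamma w.
set K := graph_space B e gamma w.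
have TP g : fs_mem K g -> extension_pair B e gamma g (T g).
  move=> Kg; apply/graphE.
  exact: (@xgetPex _ (fun=> 0) [set h | graph_S_gamma B e gamma w g h] Kg).
have pairK g h : extension_pair B e gamma g h -> fs_mem K g.
  by move=> p; exists h; apply/graphE.
have TE g h : extension_pair B e gamma g h -> T g = h.
  by move=> p; exact: uniq (TP _ (pairK _ _ p)) p.
have KB g : fs_mem K g -> fs_mem B g by move=> /TP[].
have KT g : fs_mem K g -> fs_mem B (T g) by move=> /TP[].
have Kcomb a b f g : fs_mem K f -> fs_mem K g -> fs_mem K (lincomb a f b g).
  by move=> /TP pf /TP pg; exact: pairK (extension_pair_lincomb a b sB pf pg).
have Tcomb a b f g : fs_mem K f -> fs_mem K g ->
    T (lincomb a f b g) = lincomb a (T f) b (T g).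
  by move=> /TP pf /TP pg; exact: TE (extension_pair_lincomb a b sB pf pg).
have normK f : fs_mem K f ->
    fs_norm K f = Num.sqrt (fs_norm B (T f) ^+ 2 + fs_norm B f ^+ 2).
  move=> Kf; rewrite {1}/fs_norm /K /= -/T.
  by rewrite (ip_norm_sqr iB (KT _ Kf)) (ip_norm_sqr iB (KB _ Kf)).
have normB f : fs_mem K f -> fs_norm B f <= fs_norm K f.
  by move=> Kf; rewrite normK// addrC le_sqrt_add_sqr ?sqrtr_ge0.
have normT f : fs_mem K f -> fs_norm B (T f) <= fs_norm K f.
  by move=> Kf; rewrite normK// le_sqrt_add_sqr ?sqrtr_ge0.
have [B0 _ _] := sB; have [ipJ ipD ipZ ip0 ipdef] := iB.
split.
- split.
  + by move=> f /KB; exact: Be.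
  + split.
    * apply: (pairK _ (fun=> 0)); split=> //; exists 0 => z.
      by rewrite mulr0 mul0r addr0.
    * move=> f g Kf Kg.
      rewrite (_ : (fun z => _) = lincomb 1 f 1 g); first exact: Kcomb.
      by apply/funext => z; rewrite /lincomb !mul1r.
    * move=> a f Kf.
      rewrite (_ : (fun z => _) = lincomb a f 0 f); first exact: Kcomb.
      by apply/funext => z; rewrite /lincomb mul0r addr0.
  + split.
    * move=> f g Kf Kg; rewrite /K /= conjD -!ipJ//; auto.
    * move=> f g h Kf Kg Kh.
      have -> : (fun z => g z + h z) = lincomb 1 g 1 h.
        by apply/funext => z; rewrite /lincomb !mul1r.
      rewrite /K /= -/T Tcomb// !ip_lincomb_r; auto.
      ring.
    * move=> a f g Kf Kg.
      have -> : (fun z => a * g z) = lincomb a g 0 g.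
        by apply/funext => z; rewrite /lincomb mul0r addr0.
      rewrite /K /= -/T Tcomb// !ip_lincomb_r; auto.
      ring.
    * by move=> f Kf; rewrite /K /= addr_ge0//; apply: ip0; auto.
    * move=> f Kf H; apply: ipdef; first exact: KB.
      have h1 := ip0 _ (KT _ Kf); have h2 := ip0 _ (KB _ Kf).
      by apply/eqP; rewrite eq_le h2 andbT -H /K /= lerDr.
  + move=> u Ku cau.
    have Kd m n : fs_mem K (fun z => u m z - u n z).
      by rewrite lincomb_sub; exact: Kcomb.
    have [g Bg ug] : exists2 g, fs_mem B g & forall eps : R, 0 < eps ->
        exists N : nat, forall n : nat, (N <= n)%N ->
        fs_norm B (fun z => u n z - g z) < eps.
      apply: cB => [n|eps eps0]; first exact: KB.
      have [N NP] := cau eps eps0; exists N => m n Nm Nn.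
      exact: le_lt_trans (normB _ (Kd m n)) (NP m n Nm Nn).
    have [h Bh Tuh] : exists2 h, fs_mem B h & forall eps : R, 0 < eps ->
        exists N : nat, forall n : nat, (N <= n)%N ->
        fs_norm B (fun z => T (u n) z - h z) < eps.
      apply: cB => [n|eps eps0]; first exact: KT.
      have [N NP] := cau eps eps0; exists N => m n Nm Nn.
      rewrite lincomb_sub -Tcomb// -lincomb_sub.
      exact: le_lt_trans (normT _ (Kd m n)) (NP m n Nm Nn).
    have pgh := extension_pair_closed evB (s_fun_neq0 gamma he hw)
      (fun n => TP _ (Ku n)) Bg Bh ug Tuh.
    have Kg := pairK _ _ pgh; exists g => // eps eps0.
    have e20 : 0 < eps / 2 by rewrite divr_gt0.
    have [N1 P1] := ug _ e20; have [N2 P2] := Tuh _ e20.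
    exists (maxn N1 N2) => n; rewrite geq_max => /andP[n1 n2].
    have Kun : fs_mem K (fun z => u n z - g z).
      by rewrite lincomb_sub; exact: Kcomb.
    rewrite normK//; apply: sqrt_add_sqr_lt; rewrite ?sqrtr_ge0//; last exact: P1.
    by rewrite lincomb_sub Tcomb// (TE _ _ pgh) -lincomb_sub; exact: P2.
- move=> z f Kf eps eps0; have [d d0 dP] := evB z f (KB _ Kf) eps eps0.
  exists d => // g Kg gd; apply: dP; first exact: KB.
  by apply: le_lt_trans gd; apply: normB; rewrite lincomb_sub; exact: Kcomb.
- move=> f Kf; have p := extension_pair_sharp Bsharp (TP _ Kf).
  have Ks := pairK _ _ p; split=> //.
  rewrite !normK// (TE _ _ p).
  by rewrite (sharpB _ (KB _ Kf)).2 (sharpB _ (KT _ Kf)).2.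
- move=> g v Kg hv gv.
  have [g' [Bg' g'E ng]] := divB g v (KB _ Kg) hv gv.
  have p := TP _ Kg; have [Bg Bh [c hE]] := p.
  pose h' := lincomb 1 (lincomb 1 (T g) (- conjc v) g) v g'.
  have p' : extension_pair B e gamma g' h'.
    split=> //; first by apply: lincomb_mem => //; exact: lincomb_mem.
    exists c => z; rewrite /h' /lincomb hE.
    have : (z - v) * g' z = (z - conjc v) * g z.
      have [->|zv] := eqVneq z v; first by rewrite subrr mul0r gv mulr0.
      by rewrite g'E//; field; rewrite subr_eq0.
    by move=> H; apply/eqP; rewrite -subr_eq0; apply/eqP;
      rewrite -[RHS](subrr ((z - v) * g' z)) {1}H; ring.
  have Kg' := pairK _ _ p'; exists g'; split=> //.
  rewrite !normK// (TE _ _ p') ng.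
  by rewrite (cayley_norm sB iB real p p' ng).
Qed.
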